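(* Let $\gamma>0$, $M\in\mathbb{N}$, and let $b_m$, $m=-M,\dots,M$, be complex numbers. Let $A$ be the operator on $\ell^2$ corresponding to an infinite matrix $\{a_{j,k}\}_{j,k=0}^\infty$ such that $$a_{j,j+m}=0\quad\text{if } |m|>M,$$ and, for each $m$ with $|m|\le M$, $$a_{j,j+m}=b_m\,j^{-\gamma}+o(j^{-\gamma}),\qquad j\to\infty.$$ Then the singular values of $A$ satisfy $$s_n(A)=\left(\int_{-\pi}^{\pi}|b(e^{i\theta})|^{1/\gamma}\,\frac{d\theta}{2\pi}\right)^{\gamma}n^{-\gamma}+o(n^{-\gamma}),\qquad n\to\infty,$$ where $$b(e^{i\theta})=\sum_{k=-M}^{M}b_k\,e^{ik\theta}.$$
   Context: $\ell^2$ is the Hilbert space of square summable complex sequences indexed by $j=0,1,2,\dots$. Entries $a_{j,j+m}$ are considered only for indices with $j\ge0$ and $j+m\ge 0$. Under the stated assumptions $A$ is compact. For a compact operator $T$ in a Hilbert space, $\{s_n(T)\}_{n=0}^\infty$ is the non-increasing sequence of singular values of $T$ (eigenvalues of $|T|=\sqrt{T^*T}$), enumerated with multiplicities. *)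

(* Defs.v *)
From HB Require Import structures.
From mathcomp Require Import all_boot all_order all_algebra.
From mathcomp Require Import all_classical all_reals all_analysis.
From mathcomp Require Import complex ring.

Set Implicit Arguments.
Unset Strict Implicit.
Unset Printing Implicit Defensive.

Import Order.TTheory GRing.Theory Num.Theory.
Import numFieldNormedType.Exports.
Import ComplexField.Normc.

Local Open Scope classical_set_scope.
Local Open Scope complex_scope.
Local Open Scope ring_scope.

(* [R[i]] carries its modulus topology and its structure of module over itself
   through the regular alias [R[i]^o]; [normc z : R] is the modulus of [z]. *)

Section SquareSummable.
Variable R : realType.

Definition square_summable : {pred nat -> R[i]^o} :=
  fun x => `[< cvgn (series (fun n => normc (x n) ^+ 2)) >].

Lemma square_summable_submod : submod_closed square_summable.
Proof.
have ge0 (x : nat -> R[i]^o) n : 0 <= normc (x n) ^+ 2 by rewrite sqr_ge0.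
have nc0 (z : R[i]) : 0 <= normc z by case: z => p q; rewrite /normc sqrtr_ge0.
split.
  apply/asboolP; rewrite (_ : series _ = cst 0); first exact: is_cvg_cst.
  apply/funext => n; rewrite /series /= big1// => i _.
  by rewrite !expr0n addr0 sqrtr0 expr0n.
move=> c x y /asboolP cx /asboolP cy; apply/asboolP.
pose u : R^nat := fun n => normc (x n) ^+ 2.
pose v : R^nat := fun n => normc (y n) ^+ 2.
have cw : cvgn (series ((2 * normc c ^+ 2) *: u + 2 *: v)).
  by apply: is_cvg_seriesD; apply: is_cvg_seriesZ.
apply: (series_le_cvg _ _ _ cw) => n; first exact: ge0.
  by rewrite addr_ge0 // mulr_ge0 ?mulr_ge0 ?sqr_ge0.
have le1 : normc (c * x n + y n) <= normc c * normc (x n) + normc (y n).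
  by rewrite (le_trans (le_normcD _ _)) // normcM.
apply: (@le_trans _ _ ((normc c * normc (x n) + normc (y n)) ^+ 2)).
  by rewrite ler_pXn2r ?nnegrE ?nc0 ?addr_ge0 ?mulr_ge0 ?nc0.
change ((normc c * normc (x n) + normc (y n)) ^+ 2 <=
        2 * normc c ^+ 2 * normc (x n) ^+ 2 + 2 * normc (y n) ^+ 2).
rewrite -subr_ge0.
rewrite (_ : _ - _ = (normc c * normc (x n) - normc (y n)) ^+ 2) ?sqr_ge0 //.
ring.
Qed.

HB.instance Definition _ :=
  GRing.isSubmodClosed.Build _ _ square_summable square_summable_submod.

Record l2 := L2 { l2val :> nat -> R[i]^o; _ : l2val \in square_summable }.

HB.instance Definition _ := [isSub for l2val].
HB.instance Definition _ := [Choice of l2 by <:].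
HB.instance Definition _ := [SubChoice_isSubLmodule of l2 by <:].

End SquareSummable.

Section Operators.
Variable R : realType.
Implicit Types (T P S : l2 R -> l2 R) (x y : l2 R).

Definition dot x y : R[i] :=
  limn (fun n => \sum_(k < n) x k * (y k)^* : R[i]^o).

Definition l2norm x : R := Num.sqrt (complex.Re (dot x x)).

Definition bounded_op T :=
  linear T /\ exists c : R, forall x, l2norm (T x) <= c * l2norm x.

(* [matrix_op a x] is the sequence [j |-> \sum_k a j k * x k]. The default
   value [0] of [insubd] is only returned when this sequence is not in [l2]. *)
Definition matrix_op (a : nat -> nat -> R[i]) : l2 R -> l2 R := fun x =>
  insubd 0 (fun j => limn (fun n => \sum_(k < n) a j k * x k : R[i]^o)).

Definition adjoint T : l2 R -> l2 R :=
  xget (fun=> 0) [set S | forall x y, dot (T x) y = dot x (S y)].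

(* In [R[i]], [0 <= z] means that [z] is real and nonnegative. *)
Definition positive_op P := bounded_op P /\ forall x, 0 <= dot (P x) x.

(* |T|, the positive square root of T^* T *)
Definition abs_op T : l2 R -> l2 R :=
  xget (fun=> 0)
    [set P | positive_op P /\ forall x, P (P x) = adjoint T (T x)].

Definition eigenspace_op P (t : R[i]) : set (l2 R) := [set x | P x = t *: x].

Definition has_dim (V : set (l2 R)) (k : nat) :=
  exists v : 'I_k -> l2 R,
    (forall c : 'I_k -> R[i], \sum_i c i *: v i = 0 -> forall i, c i = 0) /\
    V = [set \sum_i c i *: v i | c in [set: 'I_k -> R[i]]].

(* The non-increasing enumeration, with multiplicities, of the eigenvalues of
   a compact positive operator. Only positive values are counted: when there
   are finitely many positive eigenvalues, the sequence ends with zeros. *)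
Definition eigenvalue_sequence P (s : nat -> R) :=
  [/\ nonincreasing_seq s,
      forall n, 0 <= s n &
      forall t : R, 0 < t -> exists k : nat,
        ([set n | s n = t] #= `I_k)%card /\ has_dim (eigenspace_op P t%:C) k].

Definition singular_value T : nat -> R :=
  xget (fun=> 0) [set s | eigenvalue_sequence (abs_op T) s].

End Operators.

Section Symbol.
Variable R : realType.

Definition expi (t : R) : R[i] := cos t +i* sin t.

(* [b (e^{i t})], the index [k < 2 M + 1] standing for the integer [k - M] *)
Definition symbol (M : nat) (b : int -> R[i]) (t : R) : R[i] :=
  \sum_(k < (2 * M).+1) b (k%:Z - M%:Z) * expi ((k%:Z - M%:Z)%:~R * t).

End Symbol.

(* Main.v *)
Require Import Defs.
From HB Require Import structures.
From mathcomp Require Import all_boot all_order all_algebra.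
From mathcomp Require Import all_classical all_reals all_analysis.
From mathcomp Require Import complex ring lra zify.

Set Implicit Arguments.
Unset Strict Implicit.
Unset Printing Implicit Defensive.

Import Order.TTheory GRing.Theory Num.Theory.
Import numFieldNormedType.Exports.
Import ComplexField.Normc.

Local Open Scope classical_set_scope.
Local Open Scope complex_scope.
Local Open Scope ring_scope.

(** The singular values are compared with those of an explicit block-diagonal
   model.

   Cut the indices into consecutive blocks of a large fixed length [L], and
   replace [j `^ (- gamma)] by a constant [weight gamma L p] on the block [p].
   On the vectors that vanish within [M] of the ends of a block, the resulting
   matrix is a convolution, and the discrete Fourier transform of length [L] turns
   it into multiplication by [weight gamma L p * symbol M b (angle R L i)]
   ([sqr_l2norm_model]). The model thus has the moduli of these numbers as
   singular values, up to the block ends, which are a proportion [2 M / L] of all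
   indices. At the threshold [T `^ (- gamma)] the pair [(p, i)] is counted when
   [p.+1 * L < T * normc (symbol M b (angle R L i)) `^ gamma^-1], so that the
   count is [T * mean] up to [O(1)], where [mean] is a Riemann sum of the integral
   in the theorem ([count_above], [count_below], [Riemann_sum_cvg]). Inverting the
   relation between the count and the threshold gives the asymptotics.

   The comparison rests on the min-max principle in the form of [singular_le] and
   [singular_ge]: finitely many linear constraints shift the index of a singular
   value by their number. They are used to discard the ends of the blocks and the
   first indices, where the entries are not yet close to their asymptotic form;
   beyond an index of the order of [T] the entries are themselves below the
   threshold. On what remains the difference with the model is small in norm by
   the Schur test ([matrix_op_bound]). All the discarded proportions are made
   arbitrarily small ([block_parameters]).

   The singular values of an operator [A] are defined through a positive square
   root of [A^* A] and the dimensions of its eigenspaces, so a singular value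
   decomposition has to be constructed. The singular vectors are obtained
   greedily, by maximizing [l2norm (A x)] on the orthogonal complement of the
   previous ones; maximizers exist because a bounded sequence has a weak limit
   along an ultrafilter and [A] is compact ([exists_maximizer]). The first-order
   condition makes them eigenvectors of [A^* A] ([dot_op]). They yield a square
   root ([exists_abs_op]) and the eigenspaces of any square root
   ([singular_vectors_eigenvalue_sequence]), and the dimensions of the eigenspaces
   determine the sequence ([eigenvalue_sequence_unique]). *)

(** * The modulus of a complex number and limits of complex sequences *)

Section Modulus.
Variable R : realType.
Implicit Types z w : R[i].

Lemma normc_ge0 z : 0 <= normc z.
Proof. by case: z => p q; rewrite /normc sqrtr_ge0. Qed.

Lemma normc0E : normc (0 : R[i]) = 0. Proof. exact: normc0. Qed.

Lemma normc1E : normc (1 : R[i]) = 1. Proof. exact: normc1. Qed.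

Lemma normc_eq0 z : (normc z == 0) = (z == 0).
Proof. by apply/eqP/eqP => [/eq0_normc //|->]; rewrite normc0E. Qed.

Lemma normcD z w : normc (z + w) <= normc z + normc w.
Proof. exact: le_normcD. Qed.

Lemma normc_opp z : normc (- z) = normc z.
Proof. exact: normcN. Qed.

Lemma normc_distC z w : normc (z - w) = normc (w - z).
Proof. by rewrite -opprB normc_opp. Qed.

Lemma normc_real (r : R) : normc r%:C = `|r|.
Proof. by rewrite /normc /= expr0n addr0 sqrtr_sqr. Qed.

Lemma normc_conj z : normc z^* = normc z.
Proof. by case: z => p q; rewrite /normc /= sqrrN. Qed.

Lemma sqr_normcE z : normc z ^+ 2 = complex.Re z ^+ 2 + complex.Im z ^+ 2.
Proof. by case: z => p q /=; rewrite sqr_sqrtr ?addr_ge0 ?sqr_ge0. Qed.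

Lemma mulc_conj z : z * z^* = (normc z ^+ 2)%:C.
Proof.
rewrite sqr_normcE; case: z => p q; apply/eqP; rewrite eq_complex /=.
by apply/andP; split; apply/eqP; ring.
Qed.

Lemma normc_ge_Re z : `|complex.Re z| <= normc z.
Proof.
rewrite -(@ler_pXn2r _ 2) ?nnegrE ?normc_ge0 // real_normK ?num_real //.
by rewrite sqr_normcE lerDl sqr_ge0.
Qed.

Lemma normc_ge_Im z : `|complex.Im z| <= normc z.
Proof.
rewrite -(@ler_pXn2r _ 2) ?nnegrE ?normc_ge0 // real_normK ?num_real //.
by rewrite sqr_normcE lerDr sqr_ge0.
Qed.

Lemma normc_le_ReIm z : normc z <= `|complex.Re z| + `|complex.Im z|.
Proof.
rewrite -(@ler_pXn2r _ 2) ?nnegrE ?normc_ge0 ?addr_ge0 //.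
rewrite sqr_normcE sqrrD !real_normK ?num_real // -addrA lerD2l.
by rewrite lerDr mulrn_wge0 // mulr_ge0.
Qed.

Lemma ReD z w : complex.Re (z + w) = complex.Re z + complex.Re w.
Proof. by case: z w => [p q] [r s]. Qed.

Lemma ReB z w : complex.Re (z - w) = complex.Re z - complex.Re w.
Proof. by case: z w => [p q] [r s]. Qed.

Lemma ImB z w : complex.Im (z - w) = complex.Im z - complex.Im w.
Proof. by case: z w => [p q] [r s]. Qed.

Lemma ReZ (r : R) z : complex.Re (r%:C * z) = r * complex.Re z.
Proof. by case: z => p q /=; rewrite mul0r subr0. Qed.

Lemma Re_conj z : complex.Re z^* = complex.Re z. Proof. by case: z. Qed.

Lemma conjc0E : (0 : R[i])^* = 0. Proof. exact: conjc0. Qed.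

Lemma conjc_realE (r : R) : r%:C^* = r%:C. Proof. exact: conjc_real. Qed.

Lemma conjcM z w : (z * w)^* = z^* * w^*. Proof. exact: rmorphM. Qed.

Lemma conjcD z w : (z + w)^* = z^* + w^*. Proof. exact: rmorphD. Qed.

Lemma conjcN z : (- z)^* = - z^*. Proof. exact: rmorphN. Qed.

Lemma conjcE z : z^*^* = z. Proof. exact: conjcK. Qed.

Lemma normc_sum (I : Type) (r : seq I) (P : pred I) (F : I -> R[i]) :
  normc (\sum_(i <- r | P i) F i) <= \sum_(i <- r | P i) normc (F i).
Proof.
elim/big_ind2 : _ => [|x1 x2 y1 y2 h1 h2|//]; first by rewrite normc0E.
by rewrite (le_trans (normcD _ _)) // lerD.
Qed.

Lemma Re_sum (I : Type) (r : seq I) (P : pred I) (F : I -> R[i]) :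
  complex.Re (\sum_(i <- r | P i) F i) = \sum_(i <- r | P i) complex.Re (F i).
Proof. by elim/big_rec2 : _ => // i y1 y2 _ <-; rewrite ReD. Qed.

Lemma conjc_sum (I : Type) (r : seq I) (P : pred I) (F : I -> R[i]) :
  (\sum_(i <- r | P i) F i)^* = \sum_(i <- r | P i) (F i)^*.
Proof.
exact: rmorph_sum.
Qed.

Lemma real_complex_sum (I : Type) (r : seq I) (P : pred I) (F : I -> R) :
  (\sum_(i <- r | P i) F i)%:C = \sum_(i <- r | P i) (F i)%:C.
Proof. exact: rmorph_sum. Qed.

End Modulus.

Lemma eq_cvg_to (T : Type) (U : topologicalType) (F : set_system T)
    (f g : T -> U) (l : U) : f =1 g -> f @ F --> l -> g @ F --> l.
Proof. by move=> /funext ->. Qed.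

Lemma ler_sum_ord (R : numDomainType) (F : nat -> R) (m n : nat) :
  (forall k, 0 <= F k) -> (m <= n)%N -> \sum_(k < m) F k <= \sum_(k < n) F k.
Proof.
move=> F0 mn; rewrite -!(big_mkord xpredT F) [leRHS](big_cat_nat (n := m)) //=.
by rewrite lerDl sumr_ge0.
Qed.

Section ComplexLimits.
Context {R : realType} {T : Type} {F : set_system T} {FF : Filter F}.
Implicit Types (u v : T -> R[i]^o) (l : R[i]).

(** The norm of [R[i]] takes its values in [R[i]]; this moves every limit to
   the real-valued modulus, where the order of [R] is available. *)
Lemma cvg_normcP u l :
  (u @ F --> (l : R[i]^o)) <-> (fun t => normc (u t - l)) @ F --> (0 : R).
Proof.
split=> [/cvgrPdistC_lt h|/cvgrPdist_lt h].
  apply/cvgrPdist_lt => e e0.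
  have /h : 0 < e%:C :> R[i] by rewrite ltcR.
  apply: filterS => t; rewrite sub0r normrN (ger0_norm (normc_ge0 _)) => ht.
  by rewrite -ltcR.
apply/cvgrPdistC_lt => e; rewrite ltcE /= => /andP[/eqP e0 e1].
have := h _ e1; apply: filterS => t.
rewrite sub0r normrN ger0_norm ?normc_ge0 // => ht.
change (((normc (u t - l))%:C) < e); rewrite ltcE /= ht.
by rewrite e0 eqxx.
Qed.

Lemma cvg_ReIm u (p q : R) :
  (fun t => complex.Re (u t)) @ F --> p ->
  (fun t => complex.Im (u t)) @ F --> q -> u @ F --> (p +i* q : R[i]^o).
Proof.
move=> up uq; apply/cvg_normcP.
apply: (@squeeze_cvgr _ _ _ _ (cst 0)
  (fun t => `|complex.Re (u t) - p| + `|complex.Im (u t) - q|)).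
- apply: nearW => t; rewrite normc_ge0 /=.
  by have := normc_le_ReIm (u t - (p +i* q)); rewrite ReB ImB.
- exact: cvg_cst.
rewrite -[X in _ --> X](addr0 0); apply: cvgD; rewrite -(normr0 R).
  by apply: cvg_norm; rewrite -(subrr p); apply: cvgB => //; exact: cvg_cst.
by apply: cvg_norm; rewrite -(subrr q); apply: cvgB => //; exact: cvg_cst.
Qed.

Lemma cvg_Re u l :
  u @ F --> (l : R[i]^o) -> (fun t => complex.Re (u t)) @ F --> complex.Re l.
Proof.
move=> /cvg_normcP /cvgrPdist_lt h; apply/cvgrPdistC_lt => e e0.
apply: filterS (h _ e0) => t; rewrite sub0r normrN ger0_norm ?normc_ge0 //.
by apply: le_lt_trans; rewrite -ReB normc_ge_Re.
Qed.

Lemma cvg_conj u l :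
  u @ F --> (l : R[i]^o) -> (fun t => (u t)^* : R[i]^o) @ F --> (l^* : R[i]^o).
Proof.
move=> /cvg_normcP h; apply/cvg_normcP; apply: (eq_cvg_to _ h) => t.
by rewrite -normc_conj rmorphB.
Qed.

Lemma cvg_normc u l :
  u @ F --> (l : R[i]^o) -> (fun t => normc (u t)) @ F --> normc l.
Proof.
move=> /cvg_normcP /cvgrPdist_lt h; apply/cvgrPdistC_lt => e e0.
apply: filterS (h _ e0) => t.
rewrite sub0r normrN (ger0_norm (normc_ge0 _)); apply: le_lt_trans.
have h1 := normcD (u t - l) l; have h2 := normcD (l - u t) (u t).
rewrite !subrK (normc_distC l) in h1 h2.
by rewrite ler_norml; apply/andP; split; lra.
Qed.

Lemma cvgcD u v l l' : u @ F --> (l : R[i]^o) -> v @ F --> (l' : R[i]^o) ->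
  (fun t => u t + v t : R[i]^o) @ F --> (l + l' : R[i]^o).
Proof. exact: cvgD. Qed.

Lemma cvgcM (c : R[i]) u l : u @ F --> (l : R[i]^o) ->
  (fun t => c * u t : R[i]^o) @ F --> (c * l : R[i]^o).
Proof.
move=> /cvg_normcP h; apply/cvg_normcP.
have : (fun t => normc c * normc (u t - l)) @ F --> normc c * 0.
  by apply: cvgM h; exact: cvg_cst.
by rewrite mulr0; apply: eq_cvg_to => t; rewrite -mulrBr normcM.
Qed.

End ComplexLimits.

Lemma cvgC_unique (R : realType) (T : Type) (F : set_system T)
    {FF : ProperFilter F} (u : T -> R[i]^o) (l l' : R[i]) :
  u @ F --> (l : R[i]^o) -> u @ F --> (l' : R[i]^o) -> l = l'.
Proof. by move=> h h'; apply: (cvg_unique _ h h'). Qed.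

(** * Geometry of the space of square summable sequences *)

Section L2Geometry.
Variable R : realType.
Implicit Types (x y z : l2 R) (c : R[i]).

Lemma cvg_seriesC (u : nat -> R[i]^o) :
  cvgn (series (fun n => normc (u n))) ->
  exists l : R[i], (fun n => \sum_(k < n) u k : R[i]^o) @ \oo --> (l : R[i]^o).
Proof.
move=> cu.
have h (f : R[i] -> R) : (forall w : R[i], `|f w| <= normc w) ->
    cvgn (series (fun n => f (u n))).
  move=> fle; apply: normed_cvg; apply: series_le_cvg cu => n //=.
  by rewrite normc_ge0.
have /cvg_ex[p hp] := h _ (@normc_ge_Re R).
have /cvg_ex[q hq] := h _ (@normc_ge_Im R).
exists (p +i* q); apply: cvg_ReIm.
  apply: (eq_cvg_to _ hp) => n.
  by rewrite /series /= big_mkord Re_sum.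
apply: (eq_cvg_to _ hq) => n.
rewrite /series /= big_mkord.
by elim/big_rec2 : _ => // i y1 y2 _ ->; case: (u i) y2 => [? ?] [].
Qed.

Lemma l2_summable x : cvgn (series (fun n => normc (x n) ^+ 2)).
Proof. by case: x => u /= /asboolP. Qed.

Lemma dot_cvg x y :
  (fun n => \sum_(k < n) x k * (y k)^* : R[i]^o) @ \oo --> (dot x y : R[i]^o).
Proof.
suff [l hl] : exists l : R[i],
    (fun n => \sum_(k < n) x k * (y k)^* : R[i]^o) @ \oo --> (l : R[i]^o).
  by rewrite /dot (cvg_lim _ hl) //; exact: norm_hausdorff.
apply: (@cvg_seriesC (fun k => x k * (y k)^*)).
have h := is_cvg_seriesD (@l2_summable x) (@l2_summable y).
apply: series_le_cvg h => n.
- exact: normc_ge0.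
- by apply: addr_ge0; exact: sqr_ge0.
rewrite normcM normc_conj.
change (normc (x n) * normc (y n) <= normc (x n) ^+ 2 + normc (y n) ^+ 2).
have := normc_ge0 (x n); have := normc_ge0 (y n); nra.
Qed.

Lemma dot_unique x y (l : R[i]) :
  (fun n => \sum_(k < n) x k * (y k)^* : R[i]^o) @ \oo --> (l : R[i]^o) ->
  dot x y = l.
Proof. by move=> h; exact: cvgC_unique (@dot_cvg x y) h. Qed.

Lemma dotC x y : dot y x = (dot x y)^*.
Proof.
apply: dot_unique.
apply: (eq_cvg_to _ (cvg_conj (@dot_cvg x y))) => n.
by rewrite conjc_sum; apply: eq_bigr => k _; rewrite conjcM conjcE mulrC.
Qed.

Lemma dot_linear c x y z : dot (c *: x + y) z = c * dot x z + dot y z.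
Proof.
apply: dot_unique.
apply: (eq_cvg_to _ (cvgcD (cvgcM (c := c) (@dot_cvg x z)) (@dot_cvg y z))) => n.
change (c * (\sum_(k < n) x k * (z k)^*) + \sum_(k < n) y k * (z k)^* =
  \sum_(k < n) (c * x k + y k) * (z k)^*).
rewrite mulr_sumr -big_split /=; apply: eq_bigr => k _.
by rewrite mulrDl mulrA.
Qed.

Lemma dotDl x y z : dot (x + y) z = dot x z + dot y z.
Proof. by rewrite -[x]scale1r dot_linear mul1r scale1r. Qed.

Lemma dot0l z : dot 0 z = 0.
Proof. by apply: (addIr (dot 0 z)); rewrite -dotDl !add0r. Qed.

Lemma dotZl c x z : dot (c *: x) z = c * dot x z.
Proof. by rewrite -[c *: x]addr0 dot_linear dot0l addr0. Qed.

Lemma dotNl x z : dot (- x) z = - dot x z.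
Proof. by rewrite -scaleN1r dotZl mulN1r. Qed.

Lemma dotBl x y z : dot (x - y) z = dot x z - dot y z.
Proof. by rewrite dotDl dotNl. Qed.

Lemma dotDr x y z : dot x (y + z) = dot x y + dot x z.
Proof. by rewrite dotC dotDl conjcD -!dotC. Qed.

Lemma dotZr c x z : dot x (c *: z) = c^* * dot x z.
Proof. by rewrite dotC dotZl conjcM -dotC. Qed.

Lemma dot0r x : dot x 0 = 0.
Proof. by rewrite dotC dot0l conjc0E. Qed.

Lemma dotNr x z : dot x (- z) = - dot x z.
Proof. by rewrite dotC dotNl conjcN -dotC. Qed.

Lemma dotBr x y z : dot x (y - z) = dot x y - dot x z.
Proof. by rewrite dotDr dotNr. Qed.

Lemma dot_suml (I : Type) (r : seq I) (P : pred I) (F : I -> l2 R) z :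
  dot (\sum_(i <- r | P i) F i) z = \sum_(i <- r | P i) dot (F i) z.
Proof.
by elim/big_rec2 : _ => [|i u v _ <-]; rewrite ?dot0l // dotDl.
Qed.

Lemma dot_sumr (I : Type) (r : seq I) (P : pred I) (F : I -> l2 R) z :
  dot z (\sum_(i <- r | P i) F i) = \sum_(i <- r | P i) dot z (F i).
Proof.
by elim/big_rec2 : _ => [|i u v _ <-]; rewrite ?dot0r // dotDr.
Qed.

Lemma Re_dot_cvg x :
  (fun n => \sum_(k < n) normc (x k) ^+ 2) @ \oo --> complex.Re (dot x x).
Proof.
by apply: (eq_cvg_to _ (cvg_Re (@dot_cvg x x))) => n; rewrite Re_sum; apply: eq_bigr => k _; rewrite mulc_conj.
Qed.

Lemma sum_normc_le n x : \sum_(k < n) normc (x k) ^+ 2 <= complex.Re (dot x x).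
Proof.
have h := @Re_dot_cvg x; rewrite -(cvg_lim _ h) //.
apply: (nondecreasing_cvgn_le (u_ := fun n => \sum_(k < n) normc (x k) ^+ 2)).
  move=> i j ij; apply: (ler_sum_ord (F := fun k => normc (x k) ^+ 2)) => // k.
  exact: sqr_ge0.
by apply/cvg_ex; exists (complex.Re (dot x x)).
Qed.

Lemma dotxx_ge0 x : 0 <= complex.Re (dot x x).
Proof. by have := sum_normc_le 0 x; rewrite big_ord0. Qed.

Lemma l2norm_ge0 x : 0 <= l2norm x. Proof. exact: sqrtr_ge0. Qed.

Lemma sqr_l2norm x : l2norm x ^+ 2 = complex.Re (dot x x).
Proof. by rewrite sqr_sqrtr ?dotxx_ge0. Qed.

Lemma dotxx x : dot x x = (l2norm x ^+ 2)%:C.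
Proof.
rewrite sqr_l2norm; have := dotC x x; case: (dot x x) => p q /= [] h.
by congr (_ +i* _); lra.
Qed.

Lemma l2norm_sum_le n x : \sum_(k < n) normc (x k) ^+ 2 <= l2norm x ^+ 2.
Proof. by rewrite sqr_l2norm sum_normc_le. Qed.

Lemma normc_le_l2norm x k : normc (x k) <= l2norm x.
Proof.
rewrite -(@ler_pXn2r _ 2) ?nnegrE ?normc_ge0 ?l2norm_ge0 //.
apply: le_trans (l2norm_sum_le k.+1 x).
by rewrite big_ord_recr /= lerDr sumr_ge0 // => i _; rewrite sqr_ge0.
Qed.

(** Only partial sums occur in the hypothesis, so that finite computations
   suffice to estimate a norm. *)
Lemma l2norm_le_bound x (c : R) : 0 <= c ->
  (forall n, \sum_(k < n) normc (x k) ^+ 2 <= c ^+ 2) -> l2norm x <= c.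
Proof.
move=> c0 h; rewrite -(@ler_pXn2r _ 2) ?nnegrE ?l2norm_ge0 // sqr_l2norm.
have cx := @Re_dot_cvg x; rewrite -(cvg_lim _ cx) //; apply: limr_le.
  by apply/cvg_ex; eexists; exact: cx.
by apply: nearW => n; exact: h.
Qed.

Lemma l2_ext x y : (forall k, x k = y k) -> x = y.
Proof. by move=> h; apply/val_inj/funext. Qed.

Lemma l2norm0 : l2norm (0 : l2 R) = 0.
Proof. by rewrite /l2norm dot0l sqrtr0. Qed.

Lemma l2norm_eq0 x : l2norm x = 0 -> x = 0.
Proof.
move=> h; apply: l2_ext => k; apply/eqP; rewrite -normc_eq0.
by rewrite eq_le normc_ge0 -h normc_le_l2norm.
Qed.

Lemma l2norm_gt0 x : x <> 0 -> 0 < l2norm x.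
Proof.
move=> x0; rewrite lt_def l2norm_ge0 andbT; apply/eqP => /l2norm_eq0.
exact: x0.
Qed.

Lemma l2normZ c x : l2norm (c *: x) = normc c * l2norm x.
Proof.
apply/eqP; rewrite -(@eqrXn2 _ 2) ?mulr_ge0 ?normc_ge0 ?l2norm_ge0 //.
rewrite exprMn !sqr_l2norm dotZl dotZr mulrA mulc_conj ReZ.
by rewrite -sqr_l2norm.
Qed.

Lemma l2normN x : l2norm (- x) = l2norm x.
Proof. by rewrite -scaleN1r l2normZ normc_opp normc1E mul1r. Qed.

(** For [c = - r z^*] with [r] real the hypothesis is a real quadratic inequality
   in [r], whose discriminant gives the bound. With [alpha] and [beta] squared
   norms this is the Cauchy-Schwarz inequality; with [alpha = 0] it is the
   first-order condition satisfied by a maximizer. *)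
Lemma sesqui_discriminant (alpha beta : R) (z : R[i]) : 0 <= beta ->
  (forall c, 0 <= alpha + 2 * complex.Re (c * z) + normc c ^+ 2 * beta) ->
  normc z ^+ 2 <= alpha * beta.
Proof.
move=> b0 h.
have hr (r : R) : 0 <= alpha - 2 * r * normc z ^+ 2 + r ^+ 2 * normc z ^+ 2 * beta.
  have := h ((- r)%:C * z^*).
  rewrite -mulrA [_^* * z]mulrC mulc_conj normcM normc_real normc_conj.
  rewrite ReZ /= exprMn real_normK ?num_real //.
  by rewrite sqrrN mulNr mulrN mulrA.
have [z0|z0] := eqVneq (normc z) 0.
  have := h 0; rewrite mul0r normc0E /= z0 expr0n /= mul0r !addr0 mulr0 addr0 => a0.
  exact: mulr_ge0.
have zp : 0 < normc z ^+ 2 by rewrite exprn_gt0 // lt_def z0 normc_ge0.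
have [bz|bn] := eqVneq beta 0.
  have := hr ((alpha + 1) / (2 * normc z ^+ 2)); rewrite bz mulr0 addr0.
  suff -> : 2 * ((alpha + 1) / (2 * normc z ^+ 2)) * normc z ^+ 2 = alpha + 1.
    by lra.
  by field; rewrite z0.
have bp : 0 < beta by rewrite lt_def bn.
have := hr (beta^-1).
suff -> : alpha - 2 * beta^-1 * normc z ^+ 2 + beta^-1 ^+ 2 * normc z ^+ 2 * beta
   = (alpha * beta - normc z ^+ 2) / beta.
  by rewrite pmulr_lge0 ?invr_gt0 // subr_ge0.
by field.
Qed.

Lemma sqr_l2normD x y : l2norm (x + y) ^+ 2 =
  l2norm x ^+ 2 + 2 * complex.Re (dot x y) + l2norm y ^+ 2.
Proof.
rewrite !sqr_l2norm dotDl !dotDr !ReD.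
rewrite (dotC x y) Re_conj; ring.
Qed.

Lemma sqr_l2norm_addZ x y c : l2norm (x + c^* *: y) ^+ 2 =
  l2norm x ^+ 2 + 2 * complex.Re (c * dot x y) + normc c ^+ 2 * l2norm y ^+ 2.
Proof. by rewrite sqr_l2normD dotZr conjcE l2normZ exprMn normc_conj. Qed.

Lemma CauchySchwarz x y : normc (dot x y) <= l2norm x * l2norm y.
Proof.
rewrite -(@ler_pXn2r _ 2) ?nnegrE ?normc_ge0 ?mulr_ge0 ?l2norm_ge0 //.
rewrite exprMn; apply: sesqui_discriminant => [|c]; first exact: sqr_ge0.
have := sqr_ge0 (l2norm (x + c^* *: y)).
by rewrite sqr_l2norm_addZ.
Qed.

Lemma l2normD x y : l2norm (x + y) <= l2norm x + l2norm y.
Proof.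
rewrite -(@ler_pXn2r _ 2) ?nnegrE ?addr_ge0 ?l2norm_ge0 // sqr_l2normD.
have := CauchySchwarz x y; have := le_trans (ler_norm _) (normc_ge_Re (dot x y)).
nra.
Qed.

Lemma l2normB x y : l2norm (x - y) <= l2norm x + l2norm y.
Proof. by rewrite -[l2norm y]l2normN l2normD. Qed.

Lemma dot_nondegenerate x y : (forall z, dot x z = dot y z) -> x = y.
Proof.
move=> h; apply/subr0_eq/l2norm_eq0; apply/eqP.
by rewrite -sqrf_eq0 sqr_l2norm dotBl h subrr.
Qed.

Lemma square_summable_bounded (u : nat -> R[i]) (c : R) :
  (forall n, \sum_(k < n) normc (u k) ^+ 2 <= c) -> u \in @square_summable R.
Proof.
move=> h; apply/asboolP; apply: nondecreasing_is_cvgn.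
  by apply: nondecreasing_series => n _ _; rewrite sqr_ge0.
by exists c => _ [n _ <-]; rewrite /series /= big_mkord.
Qed.

Definition l2_of (u : nat -> R[i]) (c : R)
  (h : forall n, \sum_(k < n) normc (u k) ^+ 2 <= c) : l2 R :=
  L2 (square_summable_bounded h).

End L2Geometry.

Section Truncation.
Variable R : realType.
Implicit Types (x y z : l2 R).

Lemma delta_summable (j : nat) n :
  \sum_(k < n) normc ((k == j :> nat)%:R : R[i]) ^+ 2 <= (1 : R).
Proof.
have [jn|nj] := ltnP j n.
  rewrite (bigD1 (Ordinal jn)) //= eqxx normc1E expr1n big1 ?addr0 // => i ij.
  rewrite (_ : (i == j :> nat) = false) ?normc0E ?expr0n //.
  exact: negbTE ij.
rewrite big1 ?ler01 // => i _; rewrite (_ : (i == j :> nat) = false).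
  by rewrite normc0E expr0n.
by apply/negbTE; rewrite neq_ltn (leq_trans (ltn_ord i) nj).
Qed.

Definition delta j : l2 R := @l2_of R (fun k => (k == j)%:R) 1 (delta_summable j).

Lemma deltaE j k : delta j k = (k == j)%:R. Proof. by []. Qed.

Lemma conj_delta j k : (delta j k)^* = (k == j)%:R.
Proof. by rewrite deltaE; case: (k == j); [exact: conjc1|exact: conjc0]. Qed.

Lemma dot_delta x j : dot x (delta j) = x j.
Proof.
apply: dot_unique; apply: cvg_near_cst; near=> n.
have jn : (j < n)%N by near: n; exact: nbhs_infty_gt.
rewrite (bigD1 (Ordinal jn)) //= conj_delta eqxx mulr1 big1 ?addr0 // => i ij.
rewrite conj_delta (_ : (i == j :> nat) = false) ?mulr0 //.
exact: negbTE ij.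
Unshelve. all: by end_near. Qed.

Definition trunc N x : l2 R := \sum_(j < N) x j *: delta j.

Lemma l2valB x y k : (x - y) k = x k - y k. Proof. by []. Qed.

Lemma l2valZ (c : R[i]) x k : (c *: x) k = c * x k. Proof. by []. Qed.

Lemma l2val_sum (I : Type) (r : seq I) (P : pred I) (F : I -> l2 R) k :
  (\sum_(i <- r | P i) F i) k = \sum_(i <- r | P i) F i k.
Proof. by elim/big_rec2 : _ => // i u v _ <-. Qed.

Lemma truncE N x k : trunc N x k = if (k < N)%N then x k else 0.
Proof.
rewrite l2val_sum (eq_bigr (fun i : 'I_N => x i * (k == i)%:R)) => [|i _ //].
case: ltnP => kN.
  rewrite (bigD1 (Ordinal kN)) //= eqxx mulr1 big1 ?addr0 // => i ik.
  rewrite (_ : (k == i :> nat) = false) ?mulr0 //.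
  by rewrite eq_sym; exact: negbTE ik.
rewrite big1 // => i _; rewrite (_ : (k == i :> nat) = false) ?mulr0 //.
by apply/negbTE; rewrite neq_ltn (leq_trans (ltn_ord i) kN) orbT.
Qed.

Lemma sqr_l2norm_trunc N x :
  l2norm (trunc N x) ^+ 2 = \sum_(k < N) normc (x k) ^+ 2.
Proof.
rewrite sqr_l2norm dot_suml Re_sum; apply: eq_bigr => k _.
by rewrite dotZl dotC dot_delta truncE ltn_ord mulc_conj.
Qed.

Lemma sqr_l2norm_tail N x :
  l2norm (x - trunc N x) ^+ 2 = l2norm x ^+ 2 - \sum_(k < N) normc (x k) ^+ 2.
Proof.
rewrite sqr_l2normD dotNr l2normN sqr_l2norm_trunc dot_sumr.
rewrite (eq_bigr (fun k : 'I_N => (normc (x k) ^+ 2)%:C)) => [|k _].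
  by rewrite -real_complex_sum /=; ring.
by rewrite dotZr dot_delta mulrC mulc_conj.
Qed.

Lemma cvg_l2norm_tail x : (fun N => l2norm (x - trunc N x)) @ \oo --> (0 : R).
Proof.
have h : (fun N => l2norm (x - trunc N x) ^+ 2) @ \oo --> (0 : R).
  have : (fun N => l2norm x ^+ 2 - \sum_(k < N) normc (x k) ^+ 2) @ \oo
      --> l2norm x ^+ 2 - l2norm x ^+ 2.
    apply: cvgB; first exact: cvg_cst.
    by rewrite sqr_l2norm; exact: Re_dot_cvg.
  by rewrite subrr; apply: eq_cvg_to => N; rewrite sqr_l2norm_tail.
have := cvg_comp _ _ h (@sqrt_continuous R 0); rewrite sqrtr0.
by apply: eq_cvg_to => N /=; rewrite sqrtr_sqr ger0_norm // l2norm_ge0.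
Qed.

Lemma l2norm_tail_le N x : l2norm (x - trunc N x) <= l2norm x.
Proof.
rewrite -(@ler_pXn2r _ 2) ?nnegrE ?l2norm_ge0 // sqr_l2norm_tail gerBl.
by apply: sumr_ge0 => k _; exact: sqr_ge0.
Qed.

End Truncation.

Lemma le_cvg0_eq0 (R : realType) (u : nat -> R) (v C : R) :
  0 <= v -> (forall n, v <= C * u n) -> u @ \oo --> (0 : R) -> v = 0.
Proof.
move=> v0 h hu; apply/eqP; rewrite eq_le v0 andbT.
have : (fun n => C * u n) @ \oo --> C * 0 by apply: cvgM hu; exact: cvg_cst.
rewrite mulr0 => hCu; rewrite -(cvg_lim _ hCu) //; apply: limr_ge.
  by apply/cvg_ex; exists 0.
by apply: nearW => n; exact: h.
Qed.

Lemma sqr_sum_le (R : realDomainType) (I : finType) (P : pred I) (f : I -> R) :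
  (\sum_(i | P i) f i) ^+ 2 <= #|P|%:R * \sum_(i | P i) f i ^+ 2.
Proof.
(* Lagrange's identity. *)
rewrite -subr_ge0 -(pmulr_rge0 _ (ltr0Sn R 1)).
have -> : 2 * (#|P|%:R * (\sum_(i | P i) f i ^+ 2) - (\sum_(i | P i) f i) ^+ 2)
    = \sum_(i | P i) \sum_(j | P j) (f i - f j) ^+ 2.
  under [RHS]eq_bigr => i _.
    under eq_bigr => j _ do rewrite sqrrB.
    rewrite big_split /= big_split /= sumr_const sumrN sumrMnl -mulr_sumr; over.
  rewrite /= big_split /= big_split /= sumr_const sumrN sumrMnl.
  rewrite sumrMnl -mulr_suml; ring.
by rewrite sumr_ge0 // => i _; rewrite sumr_ge0 // => j _; rewrite sqr_ge0.
Qed.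

(** * Banded matrices as operators *)

Section BandOperators.
Variable R : realType.
Implicit Types (a : nat -> nat -> R[i]) (x y : l2 R) (M : nat).

Definition near_diag M (j k : nat) := (j <= k + M)%N && (k <= j + M)%N.

Lemma near_diagC M j k : near_diag M j k = near_diag M k j.
Proof. by rewrite /near_diag andbC. Qed.

Definition banded M a := forall j k, ~~ near_diag M j k -> a j k = 0.

Definition band_mul M a (u : nat -> R[i]) (j : nat) :=
  \sum_(k < j + M.+1) a j k * u k.

Lemma band_mul_widen M a (u : nat -> R[i]) j n : banded M a ->
  (j + M < n)%N -> \sum_(k < n) a j k * u k = band_mul M a u j.
Proof.
rewrite -addnS => ha jn.
rewrite /band_mul -!(big_mkord xpredT (fun k => a j k * u k)).
rewrite (big_cat_nat (n := (j + M.+1)%N)) //= [X in _ + X]big1_seq ?addr0 //.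
move=> k /andP[_]; rewrite mem_index_iota => /andP[kj _].
by rewrite ha ?mul0r // /near_diag negb_and -!ltnNge; apply/orP; right; lia.
Qed.

Lemma card_near_diag M j n : (#|[pred k : 'I_n | near_diag M j k]| <= (2 * M).+1)%N.
Proof.
rewrite cardE -(size_map val) -(size_iota (j - M) (2 * M).+1).
apply: uniq_leq_size; first by rewrite map_inj_uniq ?enum_uniq //; exact: val_inj.
move=> _ /mapP[k + ->]; rewrite mem_enum inE => /andP[h1 h2].
by rewrite mem_iota /=; lia.
Qed.

(** Every row and every column has at most [2 M + 1] entries, whence the constant
   (this is the Schur test). The entries are only bounded where [u] does not
   vanish: the estimate will be applied to vectors that vanish exactly where the
   entries are too large. *)
Lemma band_mul_bound M a (u : nat -> R[i]) (c : R) : 0 <= c -> banded M a ->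
  (forall j k, normc (a j k * u k) <= c * normc (u k)) ->
  forall n, \sum_(j < n) normc (band_mul M a u j) ^+ 2 <=
    ((2 * M).+1%:R * c) ^+ 2 * \sum_(k < n + M) normc (u k) ^+ 2.
Proof.
move=> c0 ha hc n.
have h1 (j : 'I_n) : normc (band_mul M a u j) ^+ 2 <=
    (2 * M).+1%:R * c ^+ 2 * \sum_(k < n + M | near_diag M j k) normc (u k) ^+ 2.
  apply: (@le_trans _ _ ((c * \sum_(k < n + M | near_diag M j k) normc (u k)) ^+ 2)).
    rewrite ler_pXn2r ?nnegrE ?normc_ge0 ?mulr_ge0 //; last first.
      by apply: sumr_ge0 => k _; exact: normc_ge0.
    rewrite -(band_mul_widen u ha (n := (n + M)%N)); last by rewrite ltn_add2r.
    rewrite (le_trans (normc_sum _ _ _)) // mulr_sumr [leRHS]big_mkcond /=.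
    apply: ler_sum => k _; case: ifPn => // /ha ->.
    by rewrite mul0r normc0E.
  rewrite [leLHS]exprMn [leRHS]mulrAC [leRHS]mulrC.
  apply: ler_wpM2l; first exact: sqr_ge0.
  rewrite (le_trans (sqr_sum_le _ _)) // ler_wpM2r //.
    by apply: sumr_ge0 => k _; exact: sqr_ge0.
  by rewrite ler_nat card_near_diag.
rewrite (le_trans (ler_sum _ (fun j _ => h1 j))) // -mulr_sumr.
rewrite [X in _ <= X * _](_ : _ = (2 * M).+1%:R * c ^+ 2 * (2 * M).+1%:R); last by ring.
rewrite -[leRHS]mulrA; apply: ler_wpM2l; first by rewrite mulr_ge0 ?sqr_ge0.
rewrite (exchange_big_dep xpredT) //= mulr_sumr; apply: ler_sum => k _.
rewrite sumr_const -[leLHS]mulr_natl ler_wpM2r ?sqr_ge0 // ler_nat.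
apply: leq_trans (card_near_diag M k n); apply/eq_leq/eq_card => j.
exact: near_diagC.
Qed.

Definition bounded_entries a (c : R) := forall j k, normc (a j k) <= c.

Section OneMatrix.
Variables (M : nat) (a : nat -> nat -> R[i]) (c : R).
Hypotheses (ha : banded M a) (hc : bounded_entries a c).

Let c_ge0 : 0 <= c. Proof. exact: le_trans (normc_ge0 _) (hc 0 0). Qed.

(** The series defining [matrix_op] are finite sums, and the default value of
   [matrix_op] is never taken. *)
Lemma matrix_opE x j : matrix_op a x j = band_mul M a x j.
Proof.
have e : (fun j => limn (fun n => \sum_(k < n) a j k * x k : R[i]^o)) =
    (fun j => band_mul M a x j).
  apply/funext => i; apply: cvg_lim; first exact: norm_hausdorff.
  apply: cvg_near_cst; near=> n; apply: band_mul_widen => //.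
  by near: n; exact: nbhs_infty_gt.
rewrite /matrix_op e /insubd insubT //=.
apply: (@square_summable_bounded _ _ (((2 * M).+1%:R * c) ^+ 2 * l2norm x ^+ 2)) => n.
rewrite (le_trans (band_mul_bound c_ge0 ha _ n)) //.
  by move=> i k; rewrite normcM ler_wpM2r ?normc_ge0.
by rewrite ler_wpM2l ?sqr_ge0 // l2norm_sum_le.
Unshelve. all: by end_near. Qed.

Lemma matrix_opD x y : matrix_op a (x + y) = matrix_op a x + matrix_op a y.
Proof.
apply: l2_ext => j; apply: etrans (matrix_opE (x + y) j) _.
apply: (etrans _ (congr2 +%R (esym (matrix_opE x j)) (esym (matrix_opE y j)))).
rewrite /band_mul -big_split /=.
by apply: eq_bigr => k _; rewrite mulrDr.
Qed.

Lemma matrix_opZ (z : R[i]) x : matrix_op a (z *: x) = z *: matrix_op a x.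
Proof.
apply: l2_ext => j; apply: etrans (matrix_opE (z *: x) j) _.
apply: (etrans _ (congr1 ( *%R z) (esym (matrix_opE x j)))).
rewrite /band_mul mulr_sumr.
by apply: eq_bigr => k _; rewrite l2valZ mulrCA.
Qed.

Lemma matrix_op_bound x (d : R) : 0 <= d ->
  (forall j k, normc (a j k * x k) <= d * normc (x k)) ->
  l2norm (matrix_op a x) <= (2 * M).+1%:R * d * l2norm x.
Proof.
move=> d0 h; apply: l2norm_le_bound => [|n].
  by rewrite !mulr_ge0 ?l2norm_ge0.
under eq_bigr => j _ do rewrite matrix_opE.
rewrite (le_trans (band_mul_bound d0 ha _ n)) // [leRHS]exprMn.
by rewrite ler_wpM2l ?sqr_ge0 // l2norm_sum_le.
Qed.

Lemma matrix_op_bounded x : l2norm (matrix_op a x) <= (2 * M).+1%:R * c * l2norm x.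
Proof.
by apply: matrix_op_bound => // j k; rewrite normcM ler_wpM2r ?normc_ge0.
Qed.

End OneMatrix.

Definition adjoint_mx a : nat -> nat -> R[i] := fun j k => (a k j)^*.

Lemma banded_adjoint M a : banded M a -> banded M (adjoint_mx a).
Proof.
by move=> h j k jk; rewrite /adjoint_mx h 1?near_diagC //; exact: conjc0E.
Qed.

Lemma bounded_adjoint a c : bounded_entries a c -> bounded_entries (adjoint_mx a) c.
Proof. by move=> h j k; rewrite normc_conj. Qed.

(** The identity is clear when [y] is a vector of the canonical basis, hence for
   the truncations of [y]; the remainder tends to 0 by boundedness. *)
Lemma dot_matrix_op M a c x y : banded M a -> bounded_entries a c ->
  dot (matrix_op a x) y = dot x (matrix_op (adjoint_mx a) y).
Proof.
move=> ha hc.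
have ha' := banded_adjoint ha; have hc' := bounded_adjoint hc.
set B := matrix_op (adjoint_mx a).
have BD u v : B (u + v) = B u + B v by exact: matrix_opD ha' hc' u v.
have BZ t u : B (t *: u) = t *: B u by exact: matrix_opZ ha' hc' t u.
have hd j : dot (matrix_op a x) (delta R j) = dot x (B (delta R j)).
  rewrite dot_delta (matrix_opE ha hc); symmetry; apply: dot_unique.
  apply: cvg_near_cst; near=> n; rewrite -(band_mul_widen x ha (n := n)).
    apply: eq_bigr => k _; rewrite (matrix_opE ha' hc') /band_mul.
    case: (ltnP j (k + M.+1)) => jk; last first.
      rewrite ha ?mul0r; last by rewrite /near_diag; lia.
      rewrite big1 ?conjc0E ?mulr0 // => i _; rewrite deltaE.
      rewrite (_ : (i == j :> nat) = false) ?mulr0 //.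
      by apply/negbTE; rewrite neq_ltn (leq_trans (ltn_ord i) jk).
    rewrite (bigD1 (Ordinal jk)) //= big1 => [|i ij].
      by rewrite addr0 eqxx mulr1 conjcE mulrC.
    rewrite (_ : (i == j :> nat) = false) ?mulr0 //.
    exact: negbTE ij.
  by near: n; exact: nbhs_infty_gt.
have ht N : dot (matrix_op a x) (trunc N y) = dot x (B (trunc N y)).
  rewrite /trunc; elim/big_rec : _ => [|i z _ IH].
    by rewrite -(scale0r 0) BZ !dotZr !conjc0E !mul0r.
  by rewrite BD !dotDr IH BZ !dotZr hd.
apply/eqP; rewrite -subr_eq0 -normc_eq0; apply/eqP.
apply: (@le_cvg0_eq0 R _ _ (l2norm (matrix_op a x) +
   l2norm x * ((2 * M).+1%:R * c)) _ _ (@cvg_l2norm_tail R y)) => [|N].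
  exact: normc_ge0.
set z := y - trunc N y.
have -> : dot (matrix_op a x) y - dot x (B y) = dot (matrix_op a x) z - dot x (B z).
  have -> : y = z + trunc N y by rewrite subrK.
  by rewrite BD !dotDr ht opprD addrACA subrr addr0.
rewrite (le_trans (normcD _ _)) // normc_opp mulrDl lerD ?CauchySchwarz //.
rewrite (le_trans (CauchySchwarz _ _)) // -[leRHS]mulrA.
by rewrite ler_wpM2l ?l2norm_ge0 // matrix_op_bounded.
Unshelve. all: by end_near. Qed.

End BandOperators.

(** * Vectors annihilated by finitely many functionals *)

Lemma row_kernel_nontrivial (K : fieldType) (m n : nat) (A : 'M[K]_(n, m)) :
  (m < n)%N -> exists2 u : 'rV[K]_n, u != 0 & u *m A = 0.
Proof.
move=> mn; have : kermx A != 0.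
  rewrite -mxrank_eq0 mxrank_ker -lt0n subn_gt0.
  exact: leq_ltn_trans (rank_leq_col A) mn.
by move=> /rowV0Pn[u /sub_kermxP uA u0]; exists u.
Qed.

Section Functionals.
Variable R : realType.

(** All the dimension counts of the min-max principle reduce to this: a family of
   vectors longer than a family of linear functionals has a nontrivial
   combination that they all annihilate. *)
Lemma exists_orthogonal_combination (I : finType) (n : nat) (g : I -> l2 R)
    (v : 'I_n -> l2 R) : (#|I| < n)%N ->
  exists c : 'I_n -> R[i], (exists j, c j != 0) /\
    forall i, dot (\sum_j c j *: v j) (g i) = 0.
Proof.
move=> In; pose A := \matrix_(j < n, p < #|I|) dot (v j) (g (enum_val p)).
have [u u0 uA] := row_kernel_nontrivial A In.
exists (fun j => u 0 j); split.
  have /rV0Pn[j uj] := u0; by exists j.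
move=> i; have /rowP/(_ (enum_rank i)) := uA; rewrite !mxE => h.
rewrite dot_suml -[RHS]h; apply: eq_bigr => j _.
by rewrite dotZl mxE enum_rankK.
Qed.

End Functionals.

(** * Weak limits along an ultrafilter *)

(** Along an ultrafilter every bounded sequence of scalars converges, which
   replaces the extraction of subsequences, diagonal or not: one ultrafilter
   serves all coordinates at the same time. *)
Lemma exists_ultrafilter_at_infinity :
  exists U : set_system nat, UltraFilter U /\ \oo `<=` U.
Proof. exact: ultraFilterLemma. Qed.

Section WeakLimits.
Variables (R : realType) (U : set_system nat).
Hypothesis UU : UltraFilter U.

Let PU : ProperFilter U. Proof. exact: ultra_proper. Qed.
Local Existing Instance PU.

Lemma ultra_bounded_cvg (u : nat -> R) (c : R) :
  (forall n, `|u n| <= c) -> exists l : R, u @ U --> l.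
Proof.
move=> hu; have hU : (u @ U) `[- c, c]%classic.
  by apply: (@nearW _ U) => n; rewrite /= in_itv /= -ler_norml.
have [l [_ hl]] := @segment_compact R (- c) c (u @ U) _ hU; exists l => B Bl.
have [//|nB] := in_ultra_setVsetC (u @^-1` B) UU.
by have [z [/= ]] := hl (~` B) B nB Bl.
Qed.

Lemma ultra_bounded_cvgC (u : nat -> R[i]^o) (c : R) :
  (forall n, normc (u n) <= c) -> exists l : R[i], u @ U --> (l : R[i]^o).
Proof.
move=> hu.
have [p hp] : exists l : R, (fun n => complex.Re (u n)) @ U --> l.
  by apply: (@ultra_bounded_cvg _ c) => n; exact: le_trans (normc_ge_Re _) _.
have [q hq] : exists l : R, (fun n => complex.Im (u n)) @ U --> l.
  by apply: (@ultra_bounded_cvg _ c) => n; exact: le_trans (normc_ge_Im _) _.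
by exists (p +i* q); exact: cvg_ReIm.
Qed.

(** Weak compactness of balls: the limit is taken coordinatewise, and partial sums
   of squared moduli pass to the limit. Convergence against [y] follows by
   cutting [y] into a finite part and a small tail. *)
Lemma exists_weak_limit (X : nat -> l2 R) (c : R) : 0 <= c ->
  (forall n, l2norm (X n) <= c) ->
  exists x : l2 R, l2norm x <= c /\
    forall y, (fun n => dot (X n) y : R[i]^o) @ U --> (dot x y : R[i]^o).
Proof.
move=> c0 hX.
have /choice[x hx] : forall k, exists l : R[i],
    (fun n => X n k : R[i]^o) @ U --> (l : R[i]^o).
  move=> k; apply: (@ultra_bounded_cvgC _ c) => n.
  exact: le_trans (normc_le_l2norm _ _) (hX n).
have hsum N : \sum_(k < N) normc (x k) ^+ 2 <= c ^+ 2.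
  have hc : (fun n => \sum_(k < N) normc (X n k) ^+ 2) @ U -->
      \sum_(k < N) normc (x k) ^+ 2.
    elim: N => [|N IH].
      rewrite big_ord0; apply: (eq_cvg_to _ (cvg_cst _)) => n.
      by rewrite big_ord0.
    rewrite big_ord_recr /= [_ ^+ 2 in X in _ --> X]expr2.
    have hN : (fun n => normc (X n N)) @ U --> normc (x N) by exact: cvg_normc.
    by apply: (eq_cvg_to _ (cvgD IH (cvgM hN hN))) => n; rewrite big_ord_recr.
  rewrite -(cvg_lim _ hc) //; apply: limr_le; first by apply/cvg_ex; eexists; exact: hc.
  apply: nearW => n; apply: le_trans (l2norm_sum_le N (X n)) _.
  by rewrite ler_pXn2r ?nnegrE ?l2norm_ge0.
pose xx := @l2_of R x (c ^+ 2) hsum.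
have xxc : l2norm xx <= c by exact: l2norm_le_bound.
exists xx; split=> // y.
have ht N : (fun n => dot (X n) (trunc N y) : R[i]^o) @ U -->
    (dot xx (trunc N y) : R[i]^o).
  elim: N => [|N IH].
    rewrite /trunc big_ord0 dot0r; apply: (eq_cvg_to _ (cvg_cst _)) => n.
    by rewrite dot0r.
  rewrite /trunc big_ord_recr /= dotDr dotZr dot_delta.
  apply: (eq_cvg_to _ (cvgcD IH (cvgcM (c := (y N)^*) (hx N)))) => n.
  by rewrite dotDr dotZr dot_delta.
apply/cvg_normcP/cvgrPdist_lt => e e0.
have e2 : 0 < e / 2 / (2 * c + 1) by rewrite !divr_gt0 // ltr_wpDl ?mulr_ge0.
have [N hN] : exists N, l2norm (y - trunc N y) < e / 2 / (2 * c + 1).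
  have /cvgrPdistC_lt/(_ _ e2)[N _ hN] := @cvg_l2norm_tail R y.
  exists N; have := hN N (leqnn N); rewrite /= subr0.
  exact: le_lt_trans (ler_norm _).
have /cvg_normcP/cvgrPdist_lt hNt := ht N.
have e3 : 0 < e / 2 by rewrite divr_gt0.
apply: filterS (hNt _ e3) => n.
rewrite !sub0r !normrN !(ger0_norm (normc_ge0 _)) => h1.
have -> : dot (X n) y - dot xx y = (dot (X n) (trunc N y) - dot xx (trunc N y)) +
    dot (X n - xx) (y - trunc N y).
  rewrite dotBr !dotBl; ring.
apply: (le_lt_trans (normcD _ _)).
have h2 : normc (dot (X n - xx) (y - trunc N y)) <= 2 * c * l2norm (y - trunc N y).
  apply: (le_trans (CauchySchwarz _ _)); rewrite ler_wpM2r ?l2norm_ge0 //.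
  by apply: (le_trans (l2normB _ _)); have := hX n; lra.
have h3 : 2 * c * l2norm (y - trunc N y) <= e / 2.
  apply: (@le_trans _ _ (2 * c * (e / 2 / (2 * c + 1)))).
    by rewrite ler_wpM2l ?mulr_ge0 // ltW.
  rewrite mulrA ler_pdivrMr ?ltr_wpDl ?mulr_ge0 //.
  by rewrite mulrDr mulr1 [_ * (e / 2)]mulrC lerDl ltW.
lra.
Qed.

End WeakLimits.

(** * Singular value decomposition of a compact operator *)

Section SingularVectors.
Variables (R : realType) (T : l2 R -> l2 R) (C : R).
Implicit Types (x y z : l2 R).
Hypothesis TD : forall x y, T (x + y) = T x + T y.
Hypothesis TZ : forall (c : R[i]) x, T (c *: x) = c *: T x.
Hypothesis TC : forall x, l2norm (T x) <= C * l2norm x.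
Hypothesis C_ge0 : 0 <= C.
(* Compactness, in the form that is immediate for the matrices at hand: [T] is
   small on the vectors supported far away. *)
Hypothesis T_tail : forall eps : R, 0 < eps -> exists K : nat,
  forall x, (forall k, (k < K)%N -> x k = 0) -> l2norm (T x) <= eps * l2norm x.

Lemma op0 : T 0 = 0.
Proof. by apply: (addIr (T 0)); rewrite -TD !add0r. Qed.

Lemma opB x y : T (x - y) = T x - T y.
Proof. by rewrite -scaleN1r TD TZ scaleN1r. Qed.

Lemma op_sum (I : Type) (r : seq I) (P : pred I) (F : I -> l2 R) :
  T (\sum_(i <- r | P i) F i) = \sum_(i <- r | P i) T (F i).
Proof. by elim/big_rec2 : _ => [|i u v _ <-]; rewrite ?op0 // TD. Qed.

(** A compact operator turns weak convergence into norm convergence: the first [K]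
   coordinates of [X n - x] tend to 0, and [T] is small on the others. *)
Lemma compact_weak_cvg (U : set_system nat) (UU : UltraFilter U)
    (X : nat -> l2 R) x (c : R) :
  (forall n, l2norm (X n) <= c) -> l2norm x <= c ->
  (forall y, (fun n => dot (X n) y : R[i]^o) @ U --> (dot x y : R[i]^o)) ->
  (fun n => l2norm (T (X n - x))) @ U --> (0 : R).
Proof.
move=> hX hx hw; have PU : ProperFilter U by exact: ultra_proper.
have c0 : 0 <= c by exact: le_trans (l2norm_ge0 _) hx.
apply/cvgrPdist_lt => e e0.
have e1 : 0 < e / 2 / (2 * c + 1) by rewrite !divr_gt0 // ltr_wpDl ?mulr_ge0.
have [K hK] := T_tail e1.
have hs : (fun n => \sum_(k < K) normc ((X n - x) k) ^+ 2) @ U --> (0 : R).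
  elim: K {hK} => [|K IH].
    by apply: (eq_cvg_to _ (cvg_cst _)) => n; rewrite big_ord0.
  have h0 : (fun n => normc ((X n - x) K)) @ U --> (0 : R).
    have /cvg_normcP := hw (delta R K).
    by apply: eq_cvg_to => n; rewrite !dot_delta.
  rewrite -[X in _ --> X](addr0 0) -[X in _ --> _ + X](mulr0 0).
  apply: (eq_cvg_to _ (cvgD IH (cvgM h0 h0))) => n.
  by rewrite big_ord_recr /= expr2.
have e2 : 0 < (e / 2 / (C + 1)) ^+ 2.
  by rewrite exprn_gt0 // !divr_gt0 // ltr_wpDl.
have /cvgrPdist_lt/(_ _ e2) := hs; apply: filterS => n.
set z := X n - x; rewrite !sub0r !normrN ger0_norm; last first.
  by apply: sumr_ge0 => k _; exact: sqr_ge0.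
rewrite -sqr_l2norm_trunc ltr_pXn2r ?nnegrE ?l2norm_ge0 //; last first.
  by rewrite ltW // !divr_gt0 // ltr_wpDl.
move=> h1; rewrite (ger0_norm (l2norm_ge0 _)).
have zc : l2norm (z - trunc K z) <= 2 * c.
  apply: (le_trans (l2norm_tail_le _ _)); apply: (le_trans (l2normB _ _)).
  by have := hX n; lra.
have h2 : l2norm (T (z - trunc K z)) <= e / 2 / (2 * c + 1) * l2norm (z - trunc K z).
  apply: hK => k kK; rewrite l2valB truncE kK; exact: subrr.
have h3 : e / 2 / (2 * c + 1) * l2norm (z - trunc K z) <= e / 2.
  apply: (@le_trans _ _ (e / 2 / (2 * c + 1) * (2 * c))).
    by rewrite ler_wpM2l // ltW.
  rewrite mulrAC ler_pdivrMr ?ltr_wpDl ?mulr_ge0 //.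
  by rewrite mulrDr mulr1 lerDl; apply: ltW; rewrite divr_gt0.
have h4 : l2norm (T (trunc K z)) < e / 2.
  apply: (le_lt_trans (TC _)).
  apply: (@le_lt_trans _ _ ((C + 1) * l2norm (trunc K z))).
    by rewrite ler_wpM2r ?l2norm_ge0 // lerDl.
  by rewrite mulrC -ltr_pdivlMr // ltr_wpDl.
have -> : T z = T (z - trunc K z) + T (trunc K z) by rewrite -TD subrK.
apply: (le_lt_trans (l2normD _ _)); lra.
Qed.

Definition perp (s : seq (l2 R)) : set (l2 R) :=
  [set x | forall y, y \in s -> dot x y = 0].

Lemma perpZ s c x : perp s x -> perp s (c *: x).
Proof. by move=> h y ys; rewrite dotZl h // mulr0. Qed.

Lemma l2norm_normalize x : 0 < l2norm x -> l2norm (((l2norm x)^-1)%:C *: x) = 1.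
Proof.
move=> x0; rewrite l2normZ normc_real ger0_norm ?invr_ge0 ?l2norm_ge0 //.
by rewrite mulVf ?gt_eqF.
Qed.

Lemma exists_unit_perp s : exists x, l2norm x = 1 /\ perp s x.
Proof.
have [c [[j cj] hc]] := @exists_orthogonal_combination R 'I_(size s) (size s).+1
  (fun i => s`_i) (fun j => delta R j) (ltac:(by rewrite card_ord)).
set x := \sum_j _ in hc.
have x0 : 0 < l2norm x.
  apply: l2norm_gt0 => x0; have : x j = 0 by rewrite x0.
  rewrite -dot_delta dot_suml (bigD1 j) //= dotZl dot_delta deltaE eqxx mulr1.
  rewrite big1 ?addr0 => [|i ij]; first by apply/eqP.
  rewrite dotZl dot_delta deltaE (_ : (j == i :> nat) = false) ?mulr0 //.
  by rewrite eq_sym; exact: negbTE ij.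
exists (((l2norm x)^-1)%:C *: x); split.
  exact: l2norm_normalize.
apply: perpZ => y /(nthP 0)[i si <-]; exact: (hc (Ordinal si)).
Qed.

(** A weak limit of a maximizing sequence is a maximizer by [compact_weak_cvg];
   it has norm 1 unless the supremum is 0, in which case any unit vector
   orthogonal to [s] will do. *)
Lemma exists_maximizer s : exists e, [/\ l2norm e = 1, perp s e &
  forall x, perp s x -> l2norm (T x) <= l2norm (T e) * l2norm x].
Proof.
have [U [UU hU]] := exists_ultrafilter_at_infinity.
have PU : ProperFilter U by exact: ultra_proper.
pose S := [set l2norm (T x) | x in [set x | l2norm x <= 1 /\ perp s x]].
have S0 : has_sup S.
  split; last first.
    exists C => _ [x [x1 _] <-]; apply: (le_trans (TC _)).
    by rewrite -[leRHS]mulr1 ler_wpM2l.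
  by have [x [x1 xs]] := exists_unit_perp s; exists (l2norm (T x)), x => //=; rewrite x1.
set l := sup S.
have hl x : perp s x -> l2norm (T x) <= l * l2norm x.
  move=> xs; have [->|/eqP x0] := eqVneq x 0; first by rewrite op0 !l2norm0 mulr0.
  have xp := l2norm_gt0 x0.
  rewrite -ler_pdivrMr // mulrC.
  have -> : (l2norm x)^-1 * l2norm (T x) = l2norm (T (((l2norm x)^-1)%:C *: x)).
    by rewrite TZ l2normZ normc_real ger0_norm // invr_ge0 ltW.
  apply: sup_upper_bound => //; exists (((l2norm x)^-1)%:C *: x) => //=; split.
    by rewrite l2norm_normalize.
  exact: perpZ.
have l0 : 0 <= l.
  have [x [x1 xs]] := exists_unit_perp s.
  by have := hl x xs; rewrite x1 mulr1; apply: le_trans; exact: l2norm_ge0.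
have /choice[X hX] : forall n : nat, exists x,
    [/\ l2norm x <= 1, perp s x & l - n.+1%:R^-1 < l2norm (T x)].
  move=> n; have n0 : (0 : R) < n.+1%:R^-1 by rewrite invr_gt0.
  by have [_ [x [x1 xs] <-] h] := sup_adherent n0 S0; exists x.
have [|x [x1 hx]] := exists_weak_limit UU (X := X) (c := 1) ler01.
  by move=> n; have [] := hX n.
have xs : perp s x.
  move=> y ys; apply: cvgC_unique (hx y) _.
  apply: (eq_cvg_to _ (cvg_cst _)) => n; have [_ h _] := hX n.
  by rewrite h.
have lx : l <= l2norm (T x).
  have h1 : (fun n => n.+1%:R^-1 + l2norm (T (X n - x))) @ U --> (0 + 0 : R).
    apply: cvgD; last by apply: compact_weak_cvg (x1) hx => // n; have [] := hX n.
    exact: (cvg_trans (cvg_app _ hU) (@cvg_harmonic R)).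
  rewrite -subr_le0 -(addr0 0) -(cvg_lim _ h1) //; apply: limr_ge.
    by apply/cvg_ex; exists (0 + 0).
  apply: nearW => n; have [_ _ h] := hX n.
  have := l2normD (T (X n - x)) (T x); rewrite -TD subrK => h2.
  rewrite lerBlDr -addrA -lerBlDl; apply: le_trans h2; exact: ltW.
have [l00|lp] := eqVneq l 0.
  have [e [e1 es]] := exists_unit_perp s; exists e; split=> // y ys.
  by rewrite (le_trans (hl y ys)) // l00 mul0r mulr_ge0 ?l2norm_ge0.
have {}lp : 0 < l by rewrite lt_def lp.
have xp : 0 < l2norm x.
  apply: l2norm_gt0 => x0; move: lx; rewrite x0 op0 l2norm0; lra.
exists (((l2norm x)^-1)%:C *: x); split.
- exact: l2norm_normalize.
- exact: perpZ.
move=> y ys; apply: (le_trans (hl y ys)); rewrite ler_wpM2r ?l2norm_ge0 //.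
apply: (le_trans lx).
rewrite TZ l2normZ normc_real ger0_norm ?invr_ge0 ?l2norm_ge0 //.
by rewrite ler_peMl ?l2norm_ge0 // invf_ge1.
Qed.

(** Greedy choice of the right singular vectors: [e n] maximizes [l2norm (T x)] on
   the unit vectors orthogonal to its predecessors. *)
Lemma exists_singular_vectors : exists e : nat -> l2 R, forall n,
  [/\ l2norm (e n) = 1, forall i, (i < n)%N -> dot (e n) (e i) = 0 &
    forall x, (forall i, (i < n)%N -> dot x (e i) = 0) ->
      l2norm (T x) <= l2norm (T (e n)) * l2norm x].
Proof.
have /choice[nxt hnxt] := exists_maximizer.
pose es := fix es n := if n is n'.+1 then rcons (es n') (nxt (es n')) else [::].
exists (fun n => nxt (es n)) => n.
have esE : es n = mkseq (fun k => nxt (es k)) n.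
  by elim: n => //= n IH; rewrite [in RHS]mkseqS -IH.
have [h1 h2 h3] := hnxt (es n); split=> //.
  move=> i i_n; apply: h2; rewrite esE.
  by apply/(nthP 0); exists i; rewrite ?size_mkseq // nth_mkseq.
move=> x hx; apply: h3 => y; rewrite esE => /mapP[j].
by rewrite mem_iota => j_n ->; exact: hx.
Qed.

End SingularVectors.

Section SingularValues.
Variables (R : realType) (T : l2 R -> l2 R).
Implicit Types (x y z : l2 R).
Hypothesis TD : forall x y, T (x + y) = T x + T y.
Hypothesis TZ : forall (c : R[i]) x, T (c *: x) = c *: T x.
Hypothesis T_tail : forall eps : R, 0 < eps -> exists K : nat,
  forall x, (forall k, (k < K)%N -> x k = 0) -> l2norm (T x) <= eps * l2norm x.
Variable e : nat -> l2 R.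
Hypothesis he : forall n,
  [/\ l2norm (e n) = 1, forall i, (i < n)%N -> dot (e n) (e i) = 0 &
    forall x, (forall i, (i < n)%N -> dot x (e i) = 0) ->
      l2norm (T x) <= l2norm (T (e n)) * l2norm x].

Let s n := l2norm (T (e n)).

Let s_ge0 n : 0 <= s n. Proof. exact: l2norm_ge0. Qed.

Lemma singular_max n x : (forall i, (i < n)%N -> dot x (e i) = 0) ->
  l2norm (T x) <= s n * l2norm x.
Proof. by have [_ _ h] := he n; exact: h. Qed.

Lemma singular_orthonormal i j : dot (e i) (e j) = (i == j)%:R.
Proof.
case: ltngtP => [ij|ij|<-].
- by rewrite dotC; have [_ h _] := he j; rewrite h // conjc0E.
- by have [_ h _] := he i; rewrite h.
- by have [h _ _] := he i; rewrite dotxx h expr1n.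
Qed.

Lemma singular_nonincreasing : nonincreasing_seq s.
Proof.
apply/nonincreasing_seqP => n.
have [e1 h _] := he n.+1; have := @singular_max n (e n.+1).
by rewrite e1 mulr1; apply => i i_n; apply: h; exact: ltnW.
Qed.

(** The form [s n ^+ 2 * l2norm x ^+ 2 - l2norm (T x) ^+ 2] is nonnegative on the
   vectors orthogonal to the first [n] ones and vanishes at [e n]: so does the
   associated sesquilinear form, against [e n]. *)
Lemma dot_op_perp n x : (forall i, (i < n)%N -> dot x (e i) = 0) ->
  dot (T (e n)) (T x) = (s n ^+ 2)%:C * dot (e n) x.
Proof.
move=> hx; apply/eqP; rewrite eq_sym -subr_eq0 -normc_eq0 -sqrf_eq0 eq_le sqr_ge0 andbT.
have [e1 eperp _] := he n.
pose beta := s n ^+ 2 * l2norm x ^+ 2 - l2norm (T x) ^+ 2.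
rewrite -(mul0r beta); apply: sesqui_discriminant => [|c].
  rewrite subr_ge0 -exprMn ler_pXn2r ?nnegrE ?mulr_ge0 ?l2norm_ge0 //.
  exact: singular_max.
have hT : T (e n + c^* *: x) = T (e n) + c^* *: T x.
  by apply: (etrans (TD _ _)); congr (_ + _); exact: TZ.
have hE := sqr_l2norm_addZ (e n) x c.
have hTE := sqr_l2norm_addZ (T (e n)) (T x) c.
have hmax : l2norm (T (e n) + c^* *: T x) ^+ 2 <=
    s n ^+ 2 * l2norm (e n + c^* *: x) ^+ 2.
  rewrite -[in leLHS]hT -[leRHS]exprMn ler_pXn2r ?nnegrE ?mulr_ge0 ?l2norm_ge0 //.
  apply: singular_max => i i_n.
  by rewrite dotDl dotZl hx // eperp // mulr0 addr0.
rewrite [X in X <= _]hTE [X in _ <= _ * X]hE e1 in hmax.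
rewrite mulrBr ReB [c * (_ * _)]mulrCA ReZ /beta.
move: hmax; rewrite -/(s n); lra.
Qed.

(** In other words [e n] is an eigenvector of [T^* T]. *)
Lemma dot_op n x : dot (T (e n)) (T x) = (s n ^+ 2)%:C * dot (e n) x.
Proof.
have hlt i : (i < n)%N -> dot (T (e n)) (T (e i)) = 0.
  move=> i_n; rewrite dotC dot_op_perp.
    by rewrite singular_orthonormal ltn_eqF // mulr0 conjc0E.
  move=> j ji; rewrite singular_orthonormal gtn_eqF //.
  exact: ltn_trans ji i_n.
pose y := \sum_(i < n) dot x (e i) *: e i.
have Ty : T y = \sum_(i < n) dot x (e i) *: T (e i).
  by rewrite /y (op_sum TD); apply: eq_bigr => i _; rewrite TZ.
have -> : T x = T (x - y) + T y by rewrite -TD subrK.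
have -> : dot (e n) x = dot (e n) (x - y) + dot (e n) y by rewrite -dotDr subrK.
rewrite dotDr mulrDr; congr (_ + _).
  apply: dot_op_perp => i i_n.
  rewrite dotBl dot_suml (bigD1 (Ordinal i_n)) //= big1 => [|j ji].
    by rewrite dotZl singular_orthonormal eqxx mulr1 addr0 subrr.
  rewrite dotZl singular_orthonormal (_ : (j == i :> nat) = false) ?mulr0 //.
  exact: negbTE ji.
rewrite Ty !dot_sumr mulr_sumr; apply: eq_bigr => i _.
by rewrite !dotZr hlt // singular_orthonormal gtn_eqF ?mulr0.
Qed.

Lemma sqr_l2norm_comb n (c : 'I_n -> R[i]) :
  l2norm (\sum_i c i *: e i) ^+ 2 = \sum_i normc (c i) ^+ 2.
Proof.
rewrite sqr_l2norm dot_suml Re_sum; apply: eq_bigr => i _.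
rewrite dotZl dot_sumr (bigD1 i) //= big1 => [|j ji].
  by rewrite dotZr singular_orthonormal eqxx mulr1 addr0 mulc_conj.
rewrite dotZr singular_orthonormal (_ : (i == j :> nat) = false) ?mulr0 //.
by rewrite eq_sym; exact: negbTE ji.
Qed.

Lemma sqr_l2norm_op_comb n (c : 'I_n -> R[i]) :
  l2norm (T (\sum_i c i *: e i)) ^+ 2 = \sum_i normc (c i) ^+ 2 * s i ^+ 2.
Proof.
rewrite (op_sum TD) sqr_l2norm dot_suml Re_sum; apply: eq_bigr => i _.
rewrite TZ dotZl dot_sumr (bigD1 i) //= big1 => [|j ji].
  rewrite TZ dotZr dot_op singular_orthonormal eqxx mulr1 addr0 mulrA mulc_conj.
  by rewrite -rmorphM.
rewrite TZ dotZr dot_op singular_orthonormal (_ : (i == j :> nat) = false) ?mulr0 //.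
by rewrite eq_sym; exact: negbTE ji.
Qed.

(** Upper half of the min-max principle: the span of [e 0, ..., e n] has too
   large a dimension to avoid a subspace of codimension [n]. *)
Lemma singular_le (I : finType) (g : I -> l2 R) (c : R) n : 0 <= c ->
  (#|I| <= n)%N ->
  (forall x, (forall i, dot x (g i) = 0) -> l2norm (T x) <= c * l2norm x) ->
  s n <= c.
Proof.
move=> c0 In h.
have [a [[j aj] ha]] :=
  @exists_orthogonal_combination R I n.+1 g (fun i => e i) In.
have := h _ ha; set x := \sum_i _ => hx.
have xp : 0 < l2norm x.
  rewrite lt_def l2norm_ge0 andbT -sqrf_eq0 sqr_l2norm_comb gt_eqF //.
  rewrite (bigD1 j) //= ltr_wpDr //.
    by apply: sumr_ge0 => i _; exact: sqr_ge0.
  by rewrite exprn_gt0 // lt_def normc_eq0 aj normc_ge0.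
rewrite -(ler_pM2r xp); apply: le_trans hx.
rewrite -(@ler_pXn2r _ 2) ?nnegrE ?mulr_ge0 ?l2norm_ge0 //.
rewrite [leRHS]sqr_l2norm_op_comb [leLHS]exprMn [X in _ * X <= _]sqr_l2norm_comb mulr_sumr.
apply: ler_sum => i _.
rewrite mulrC ler_wpM2l ?sqr_ge0 // ler_pXn2r ?nnegrE //.
by apply: singular_nonincreasing; rewrite -ltnS.
Qed.

(** Lower half of the min-max principle: some nonzero vector supported by the
   first [N] indices satisfies the constraints and is orthogonal to [e 0], ...,
   [e n.-1], and there [T] is bounded by [s n]. *)
Lemma singular_ge (I : finType) (g : I -> l2 R) (c : R) N n :
  (#|I| + n < N)%N ->
  (forall x, (forall k, (N <= k)%N -> x k = 0) -> (forall i, dot x (g i) = 0) ->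
     c * l2norm x <= l2norm (T x)) ->
  c <= s n.
Proof.
move=> In h.
pose g' (i : I + 'I_n) := match i with inl i => g i | inr j => e j end.
have In' : (#|{: I + 'I_n}| < N)%N by rewrite card_sum card_ord.
have [a [[j aj] ha]] :=
  @exists_orthogonal_combination R _ N g' (fun i => delta R i) In'.
move: ha; set x := \sum_i _ => ha.
have xE k : x k = \sum_(i < N) a i * (k == i)%:R.
  by rewrite l2val_sum; apply: eq_bigr.
have xj : x j = a j.
  rewrite xE (bigD1 j) //= eqxx mulr1 big1 ?addr0 // => i ij.
  rewrite (_ : (j == i :> nat) = false) ?mulr0 //.
  by rewrite eq_sym; exact: negbTE ij.
have xp : 0 < l2norm x.
  apply: lt_le_trans (normc_le_l2norm _ j).
  by rewrite xj lt_def normc_eq0 aj normc_ge0.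
rewrite -(ler_pM2r xp); apply: le_trans (h x _ _) _.
- move=> k Nk; rewrite xE big1 // => i _; rewrite (_ : (k == i :> nat) = false) ?mulr0 //.
  by apply/negbTE; rewrite neq_ltn (leq_trans (ltn_ord i) Nk) orbT.
- by move=> i; exact: (ha (inl i)).
by apply: singular_max => i i_n; exact: (ha (inr (Ordinal i_n))).
Qed.

Lemma singular_cvg0 : s @ \oo --> (0 : R).
Proof.
apply/cvgrPdist_le => eps eps0; have [K hK] := T_tail eps0.
exists K => // n /= Kn; rewrite sub0r normrN ger0_norm //.
apply: (@singular_le 'I_K (fun k => delta R k)); rewrite ?ltW ?card_ord //.
move=> x hx; apply: hK => k kK.
by have := hx (Ordinal kK); rewrite dot_delta.
Qed.

Lemma op_eq0_of_perp x : (forall n, dot x (e n) = 0) -> T x = 0.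
Proof.
move=> hx; apply: l2norm_eq0.
apply: (@le_cvg0_eq0 R _ _ (l2norm x) _ _ singular_cvg0) => [|n].
  exact: l2norm_ge0.
by rewrite mulrC; apply: singular_max => i _; exact: hx.
Qed.

End SingularValues.

(** * The operator [|T|] and its eigenvalue sequence *)

Section AbsoluteValue.
Variables (R : realType) (T : l2 R -> l2 R).
Implicit Types (x y z : l2 R).
Hypothesis TD : forall x y, T (x + y) = T x + T y.
Hypothesis TZ : forall (c : R[i]) x, T (c *: x) = c *: T x.
Hypothesis T_tail : forall eps : R, 0 < eps -> exists K : nat,
  forall x, (forall k, (k < K)%N -> x k = 0) -> l2norm (T x) <= eps * l2norm x.
Variable e : nat -> l2 R.
Hypothesis he : forall n,
  [/\ l2norm (e n) = 1, forall i, (i < n)%N -> dot (e n) (e i) = 0 &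
    forall x, (forall i, (i < n)%N -> dot x (e i) = 0) ->
      l2norm (T x) <= l2norm (T (e n)) * l2norm x].

Let s n := l2norm (T (e n)).

Let s_ge0 n : 0 <= s n. Proof. exact: l2norm_ge0. Qed.

Let eD i j : dot (e i) (e j) = (i == j)%:R.
Proof. exact: (singular_orthonormal he). Qed.

Let proj N x := \sum_(n < N) dot x (e n) *: e n.

Lemma dot_singular_comb N (c : nat -> R[i]) j : (j < N)%N ->
  dot (\sum_(n < N) c n *: e n) (e j) = c j.
Proof.
move=> jN; rewrite dot_suml (bigD1 (Ordinal jN)) //= big1 => [|i ij].
  by rewrite dotZl eD eqxx mulr1 addr0.
rewrite dotZl eD (_ : (i == j :> nat) = false) ?mulr0 //.
exact: negbTE ij.
Qed.

Lemma sqr_l2norm_residual N x : l2norm (x - proj N x) ^+ 2 =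
  l2norm x ^+ 2 - \sum_(n < N) normc (dot x (e n)) ^+ 2.
Proof.
rewrite sqr_l2normD dotNr l2normN [X in _ + X](sqr_l2norm_comb he).
rewrite dot_sumr (eq_bigr (fun n : 'I_N => (normc (dot x (e n)) ^+ 2)%:C)).
  by rewrite -real_complex_sum /=; ring.
by move=> n _; rewrite dotZr mulrC mulc_conj.
Qed.

Lemma Bessel N x : \sum_(n < N) normc (dot x (e n)) ^+ 2 <= l2norm x ^+ 2.
Proof. by rewrite -subr_ge0 -sqr_l2norm_residual sqr_ge0. Qed.

Lemma l2norm_op_residual N x : l2norm (T (x - proj N x)) <= s N * l2norm x.
Proof.
apply: (@le_trans _ _ (s N * l2norm (x - proj N x))).
  apply: (singular_max he) => i iN.
  by rewrite dotBl (dot_singular_comb (fun n => dot x (e n)) iN) subrr.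
rewrite ler_wpM2l // -(@ler_pXn2r _ 2) ?nnegrE ?l2norm_ge0 //.
rewrite sqr_l2norm_residual gerBl.
by apply: sumr_ge0 => n _; exact: sqr_ge0.
Qed.

(** The operator is the sum of the series of [s n *: dot x (e n) *: e n], taken as
   a weak limit of its partial sums. Weak limits suffice: they preserve bounds on
   the norm, and the other properties are statements on inner products. *)
Lemma exists_abs_op : exists P : l2 R -> l2 R, positive_op P /\
  forall x y, dot (P (P x)) y = dot (T x) (T y).
Proof.
have [U [UU hU]] := exists_ultrafilter_at_infinity.
have PU : ProperFilter U by exact: ultra_proper.
pose X x N := \sum_(n < N) ((s n)%:C * dot x (e n)) *: e n.
have dotX x N y : dot (X x N) y = \sum_(n < N) (s n)%:C * dot x (e n) * dot (e n) y.
  by rewrite dot_suml; apply: eq_bigr => n _; rewrite dotZl.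
have hX x N : l2norm (X x N) <= s 0%N * l2norm x.
  rewrite -(@ler_pXn2r _ 2) ?nnegrE ?mulr_ge0 ?l2norm_ge0 //.
  rewrite [leLHS](sqr_l2norm_comb he) exprMn.
  apply: (@le_trans _ _ (s 0%N ^+ 2 * \sum_(n < N) normc (dot x (e n)) ^+ 2)).
    rewrite mulr_sumr; apply: ler_sum => n _.
    rewrite normcM normc_real ger0_norm // exprMn ler_wpM2r ?sqr_ge0 //.
    by rewrite ler_pXn2r ?nnegrE //; exact: (singular_nonincreasing he).
  by rewrite ler_wpM2l ?sqr_ge0 ?Bessel.
have /choice[P hP] : forall x, exists Px : l2 R, l2norm Px <= s 0%N * l2norm x /\
    forall y, (fun n => dot (X x n) y : R[i]^o) @ U --> (dot Px y : R[i]^o).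
  move=> x; apply: (exists_weak_limit UU).
    by rewrite mulr_ge0 ?l2norm_ge0.
  exact: hX.
have Pe x n : dot (P x) (e n) = (s n)%:C * dot x (e n).
  have [_ h] := hP x; apply: cvgC_unique (h (e n)) _; apply: cvg_near_cst.
  apply: hU; exists n.+1 => // N /= nN.
  exact: (dot_singular_comb (fun n => (s n)%:C * dot x (e n)) nN).
have Plin (c : R[i]) x y : P (c *: x + y) = c *: P x + P y.
  apply: dot_nondegenerate => z; have [_ h] := hP (c *: x + y).
  apply: cvgC_unique (h z) _.
  have [_ hx] := hP x; have [_ hy] := hP y.
  rewrite dot_linear.
  apply: (eq_cvg_to _ (cvgcD (cvgcM (c := c) (hx z)) (hy z))) => N.
  rewrite !dotX mulr_sumr -big_split /=; apply: eq_bigr => n _.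
  rewrite dot_linear; ring.
exists P; split.
  split.
    by split; [exact: Plin | exists (s 0%N) => x; have [] := hP x].
  move=> x; have [_ h] := hP x.
  have e1 N : dot (X x N) x = (\sum_(n < N) s n * normc (dot x (e n)) ^+ 2)%:C.
    rewrite dotX real_complex_sum; apply: eq_bigr => n _.
    by rewrite (dotC x (e n)) -mulrA mulc_conj -rmorphM.
  rewrite lecE /=; apply/andP; split.
    apply/eqP; have : dot (P x) x = (dot (P x) x)^*.
      apply: cvgC_unique (h x) _.
      by apply: (eq_cvg_to _ (cvg_conj (h x))) => N; rewrite e1 conjc_realE.
    case: (dot _ _) => p q /= [] h0; lra.
  rewrite -(cvg_lim _ (cvg_Re (h x))) //; apply: limr_ge.
    by apply/cvg_ex; eexists; exact: cvg_Re (h x).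
  apply: nearW => N; rewrite e1 /=; apply: sumr_ge0 => n _.
  by rewrite mulr_ge0 ?sqr_ge0.
move=> x y; have [_ h] := hP (P x); apply: cvgC_unique (h y) _.
have hr N : dot (X (P x) N) y = dot (T (proj N x)) (T y).
  rewrite dotX /proj (op_sum TD) dot_suml; apply: eq_bigr => n _.
  rewrite Pe (TZ (dot x (e n)) (e n)) dotZl (dot_op TD TZ he) rmorphXn /=.
  rewrite -/(s n); ring.
apply/cvg_normcP; apply: (@squeeze_cvgr _ _ _ _ (cst 0)
  (fun N => s N * (l2norm x * l2norm (T y)))).
- apply: nearW => N; rewrite normc_ge0 hr -dotBl.
  have -> : T (proj N x) - T x = - T (x - proj N x).
    by rewrite (opB TD TZ) opprB.
  rewrite dotNl normc_opp mulrA; apply: (le_trans (CauchySchwarz _ _)).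
  by rewrite ler_wpM2r ?l2norm_ge0 // l2norm_op_residual.
- exact: cvg_cst.
rewrite -[X in _ --> X](mul0r (l2norm x * l2norm (T y))).
apply: cvgM; last exact: cvg_cst.
exact: (cvg_trans (cvg_app _ hU) (singular_cvg0 TD TZ T_tail he)).
Qed.

Section Eigenspaces.
Variable P : l2 R -> l2 R.
Hypothesis P_pos : positive_op P.
Hypothesis PP : forall x y, dot (P (P x)) y = dot (T x) (T y).

Let PD x y : P (x + y) = P x + P y.
Proof. by have [[h _] _] := P_pos; have := h 1 x y; rewrite !scale1r. Qed.

Let P0 : P 0 = 0. Proof. by apply: (addIr (P 0)); rewrite -PD !add0r. Qed.

Let PZ (c : R[i]) x : P (c *: x) = c *: P x.
Proof. by have [[h _] _] := P_pos; have := h c x 0; rewrite P0 !addr0. Qed.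

(** As [P + t] is injective for [t > 0], the factorization
   [P ^ 2 - t ^ 2 = (P + t) (P - t)] reduces the eigenvectors of [P] to those
   of [T^* T]. *)
Lemma eigenspace_abs_op (t : R) x : 0 < t ->
  eigenspace_op P t%:C x <->
  forall y, dot (T x) (T y) = (t ^+ 2)%:C * dot x y.
Proof.
move=> t0; split=> [Px y|h].
  by rewrite -PP Px PZ Px scalerA dotZl -rmorphM expr2.
pose w := P x - t%:C *: x.
have Pw : P w = - (t%:C *: w).
  have -> : P w = P (P x) - t%:C *: P x.
    by rewrite /w -scaleN1r PD !PZ scaleN1r.
  have -> : P (P x) = (t ^+ 2)%:C *: x.
    by apply: dot_nondegenerate => y; rewrite PP h dotZl.
  rewrite /w scalerBr scalerA opprB; congr (_ *: x - _).
  by rewrite -rmorphM expr2.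
have [_ /(_ w)] := P_pos; rewrite Pw dotNl dotZl dotxx -rmorphM -rmorphN ler0c.
rewrite oppr_ge0 pmulr_rle0 // => w0.
have : l2norm w = 0 by apply/eqP; rewrite -sqrf_eq0 eq_le w0 sqr_ge0.
by move=> /l2norm_eq0 /subr0_eq.
Qed.

(** The [e n] with [s n = t] form a basis of the eigenspace of [P] for the eigenvalue
   [t > 0]: what remains of an eigenvector after removing its components on them
   is orthogonal to all [e n], hence killed by [T], hence 0. *)
Lemma singular_vectors_eigenvalue_sequence : eigenvalue_sequence P s.
Proof.
split=> [|n|t t0]; [exact: (singular_nonincreasing he)|exact: s_ge0|].
have [K hK] : exists K, forall n, s n = t -> (n < K)%N.
  have /cvgrPdist_lt/(_ _ t0)[K _ hK] := singular_cvg0 TD TZ T_tail he.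
  exists K => n snt; rewrite ltnNge; apply/negP => /hK /=.
  by rewrite sub0r normrN ger0_norm ?l2norm_ge0 // -/(s n) snt ltxx.
pose idx := [seq n <- iota 0 K | s n == t].
have idxP n : reflect (s n = t) (n \in idx).
  apply: (iffP idP); first by rewrite mem_filter => /andP[/eqP].
  by move=> snt; rewrite mem_filter snt eqxx mem_iota /= hK.
have idx_uniq : uniq idx by rewrite filter_uniq ?iota_uniq.
exists (size idx); split.
  apply: card_esym; apply/card_set_bijP; exists (nth 0%N idx); split.
  - by move=> i /= ik; apply/idxP; exact: mem_nth.
  - move=> i j; rewrite !inE => ik jk /eqP.
    by rewrite nth_uniq // => /eqP.
  - move=> n /= /idxP nidx; exists (index n idx); last exact: nth_index.
    by rewrite /= index_mem.
pose v (i : 'I_(size idx)) := e (nth 0%N idx i).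
have sv (i : 'I_(size idx)) : s (nth 0%N idx i) = t.
  by apply/idxP; rewrite mem_nth.
have vD i j : dot (v i) (v j) = (i == j)%:R by rewrite eD nth_uniq.
have dotv (c : 'I_(size idx) -> R[i]) j : dot (\sum_i c i *: v i) (v j) = c j.
  rewrite dot_suml (bigD1 j) //= big1 => [|i ij].
    by rewrite dotZl vD eqxx mulr1 addr0.
  by rewrite dotZl vD (negbTE ij) mulr0.
have vE (c : 'I_(size idx) -> R[i]) : eigenspace_op P t%:C (\sum_i c i *: v i).
  apply/(eigenspace_abs_op _ t0) => y; rewrite (op_sum TD) !dot_suml mulr_sumr.
  apply: eq_bigr => i _; rewrite (TZ (c i) (v i)) !dotZl (dot_op TD TZ he).
  by rewrite -/(s (nth 0%N idx i)) sv mulrCA.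
exists v; split=> [c hc i|]; first by rewrite -(dotv c i) hc dot0l.
apply/seteqP; split=> [x Px|_ [c _ <-]]; last exact: vE.
exists (fun i => dot x (v i)) => //; symmetry.
set y := \sum_i _; apply/subr0_eq; set z := x - y.
have Pz : forall u, dot (T z) (T u) = (t ^+ 2)%:C * dot z u.
  apply/(eigenspace_abs_op _ t0); rewrite /eigenspace_op /= /z.
  have := vE (fun i => dot x (v i)); rewrite -/y /eigenspace_op /= => Py.
  by rewrite -[- y]scaleN1r PD PZ Py Px scalerDr !scalerA [_ * -1]mulrC.
have ze n : dot z (e n) = 0.
  have [/idxP nidx|nidx] := eqVneq (s n) t.
    have ni : (index n idx < size idx)%N by rewrite index_mem.
    have := dotv (fun i => dot x (v i)) (Ordinal ni).
    have -> : v (Ordinal ni) = e n by rewrite /v /= nth_index.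
    by rewrite dotBl => ->; rewrite subrr.
  have h1 := Pz (e n); rewrite dotC (dot_op TD TZ he) -/(s n) in h1.
  move: h1; rewrite conjcM conjc_realE -dotC => /eqP.
  rewrite -subr_eq0 -mulrBl -rmorphB mulf_eq0 => /orP[|/eqP //].
  rewrite -(inj_eq (@complexI R)) in nidx.
  rewrite (fmorph_eq0 (real_complex R)) subr_eq0 eqrXn2 // ?(ltW t0) //.
  by rewrite -(inj_eq (@complexI R)) (negbTE nidx).
have Tz : T z = 0 by exact: (op_eq0_of_perp TD TZ T_tail he).
have := Pz z; rewrite Tz dot0l dotxx -rmorphM => /eqP.
rewrite eq_sym (fmorph_eq0 (real_complex R)) mulf_eq0 !sqrf_eq0 gt_eqF //=.
by move=> /eqP /l2norm_eq0.
Qed.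

End Eigenspaces.
End AbsoluteValue.

Section Uniqueness.
Variable R : realType.

Lemma has_dim_le (V : set (l2 R)) k k' : has_dim V k -> has_dim V k' -> (k <= k')%N.
Proof.
move=> [v [vfree vV]] [w [_ wV]]; rewrite leqNgt; apply/negP => kk.
have /choice[c hc] : forall i : 'I_k, exists c : 'I_k' -> R[i],
    \sum_j c j *: w j = v i.
  move=> i; have : V (v i).
    rewrite vV; exists (fun j => (j == i)%:R) => //.
    rewrite (bigD1 i) //= eqxx scale1r big1 ?addr0 // => j /negbTE ->.
    by rewrite scale0r.
  by rewrite wV => -[c _ <-]; exists c.
have [u /rV0Pn[i0 ui0] uA] := row_kernel_nontrivial (\matrix_(i, j) c i j) kk.
suff /vfree/(_ i0)/eqP : \sum_i u 0 i *: v i = 0 by rewrite (negbTE ui0).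
under eq_bigr => i _ do rewrite -hc scaler_sumr.
rewrite exchange_big /= big1 // => j _.
under eq_bigr => i _ do rewrite scalerA.
rewrite -scaler_suml; have /rowP/(_ j) := uA; rewrite !mxE => h.
rewrite [X in X *: _](_ : _ = 0) ?scale0r // -[RHS]h.
by apply: eq_bigr => i _; rewrite mxE.
Qed.

(** A non-increasing sequence is recovered from the cardinals of its positive
   level sets: at the first disagreement the larger value would be taken once
   more by one sequence than by the other. *)
Lemma eigenvalue_sequence_unique (P : l2 R -> l2 R) (s s' : nat -> R) :
  eigenvalue_sequence P s -> eigenvalue_sequence P s' -> s = s'.
Proof.
have key (u v : nat -> R) n : eigenvalue_sequence P u -> eigenvalue_sequence P v ->
    (forall k, (k < n)%N -> u k = v k) -> u n <= v n.
  move=> [u1 u2 u3] [v1 v2 v3] huv; rewrite leNgt; apply/negP => vu.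
  have t0 : 0 < u n := le_lt_trans (v2 n) vu.
  have [k [ku hk]] := u3 _ t0; have [k' [kv hk']] := v3 _ t0.
  have kk : k = k' by apply/eqP; rewrite eqn_leq !(has_dim_le hk hk', has_dim_le hk' hk).
  rewrite -{k' hk'}kk in kv.
  pose A := [set j | v j = u n].
  have A_lt j : A j -> (j < n)%N.
    move=> /= vj; rewrite ltnNge; apply/negP => nj.
    by have := v1 _ _ nj; rewrite vj leNgt vu.
  pose B := [set j | u j = u n].
  have AB : A `<=` B by move=> j Aj; rewrite /B /= huv // A_lt.
  have finA : finite_set A by apply/finite_setP; exists k.
  have finB : finite_set B by apply/finite_setP; exists k.
  have AsubB : finmap.fsubset (fset_set A) (fset_set B) by rewrite -fset_set_sub.
  have := finmap.eqEfcard (fset_set A) (fset_set B).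
  rewrite AsubB (card_fset_set kv) (card_fset_set ku) leqnn => /eqP.
  move=> /(fset_set_inj finA finB) AE.
  have : B n by [].
  by rewrite -AE => /A_lt; rewrite ltnn.
move=> hs hs'; apply/funext; elim/ltn_ind => n IH.
apply/eqP; rewrite eq_le (key _ _ _ hs hs' IH) (key _ _ _ hs' hs) // => k kn.
by rewrite IH.
Qed.
End Uniqueness.

Lemma adjointP (R : realType) (T S : l2 R -> l2 R) :
  (forall x y, dot (T x) y = dot x (S y)) ->
  forall x y, dot (T x) y = dot x (adjoint T y).
Proof.
move=> h; exact: (@xgetPex _ (fun=> 0) [set S' | forall x y, dot (T x) y = dot x (S' y)]
  (ex_intro _ S h)).
Qed.

Section SingularValueSystem.
Variables (R : realType) (T S : l2 R -> l2 R) (C : R).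
Implicit Types (x y : l2 R).
Hypothesis TD : forall x y, T (x + y) = T x + T y.
Hypothesis TZ : forall (c : R[i]) x, T (c *: x) = c *: T x.
Hypothesis TC : forall x, l2norm (T x) <= C * l2norm x.
Hypothesis C_ge0 : 0 <= C.
Hypothesis T_tail : forall eps : R, 0 < eps -> exists K : nat,
  forall x, (forall k, (k < K)%N -> x k = 0) -> l2norm (T x) <= eps * l2norm x.
Hypothesis TS : forall x y, dot (T x) y = dot x (S y).

(** From here on the singular values are handled through the greedy vectors: the
   choices hidden in [adjoint], [abs_op] and [singular_value] are harmless since
   the adjoint exists, any positive square root has the same eigenspaces for
   positive eigenvalues, and these determine the sequence. *)
Lemma exists_singular_system : exists e : nat -> l2 R,
  (forall n, [/\ l2norm (e n) = 1, forall i, (i < n)%N -> dot (e n) (e i) = 0 &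
    forall x, (forall i, (i < n)%N -> dot x (e i) = 0) ->
      l2norm (T x) <= l2norm (T (e n)) * l2norm x]) /\
  forall n, singular_value T n = l2norm (T (e n)).
Proof.
have [e he] := exists_singular_vectors TD TZ TC C_ge0 T_tail.
exists e; split=> // n.
have adjT x y : dot (adjoint T (T x)) y = dot (T x) (T y).
  by rewrite dotC -(adjointP TS) -dotC.
have [P [P_pos PP]] := exists_abs_op TD TZ T_tail he.
have [Q_pos QQ] : positive_op (abs_op T) /\
    forall x, abs_op T (abs_op T x) = adjoint T (T x).
  apply: (@xgetPex _ (fun=> 0)
    [set P | positive_op P /\ forall x, P (P x) = adjoint T (T x)]).
  exists P; split=> // x; apply: dot_nondegenerate => y.
  by rewrite PP adjT.
have QT x y : dot (abs_op T (abs_op T x)) y = dot (T x) (T y) by rewrite QQ adjT.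
have hs := singular_vectors_eigenvalue_sequence TD TZ T_tail he Q_pos QT.
have hsv : eigenvalue_sequence (abs_op T) (singular_value T).
  exact: (@xgetPex _ (fun=> 0) [set s | eigenvalue_sequence (abs_op T) s]
    (ex_intro _ _ hs)).
by rewrite (eigenvalue_sequence_unique hsv hs).
Qed.

End SingularValueSystem.

(** * Real powers and Riemann sums *)

Section RealAnalysis.
Variable R : realType.

(** The sign condition on [u] matters when [l = 0], as [x `^ p = 1] for [x < 0]. *)
Lemma cvg_powR (T : Type) (F : set_system T) (FF : Filter F) (u : T -> R) (l p : R) :
  0 < p -> (forall t, 0 <= u t) -> 0 <= l -> u @ F --> l ->
  (fun t => u t `^ p) @ F --> l `^ p.
Proof.
move=> p0 u0; rewrite le_eqVlt => /predU1P[<-|l0] ul.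
  rewrite powR0 ?gt_eqF //; apply/cvgrPdist_lt => e e0.
  have e1 : 0 < e `^ p^-1 by exact: powR_gt0.
  have /cvgrPdist_lt/(_ _ e1) := ul; apply: filterS => t.
  rewrite !sub0r !normrN !ger0_norm ?powR_ge0 // => h.
  have -> : e = (e `^ p^-1) `^ p by rewrite -powRrM mulVf ?gt_eqF // powRr1 // ltW.
  by rewrite gt0_ltr_powR // nnegrE ?u0 ?powR_ge0.
have : {for l, continuous (fun x : R => x `^ p)}.
  apply: differentiable_continuous; apply/derivable1_diffP.
  by apply: derivable_powR; rewrite in_itv /= l0.
by move=> h; apply: (cvg_comp _ _ ul h).
Qed.

(** Heine-Cantor: two sequences violating uniform continuity would have the same
   limit along an ultrafilter. *)
Lemma continuous_uniformly (f : R -> R) (a b eps : R) : continuous f -> 0 < eps ->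
  exists2 d : R, 0 < d & forall x y, a <= x <= b -> a <= y <= b ->
    `|x - y| < d -> `|f x - f y| < eps.
Proof.
move=> fc eps0; apply: contrapT => hn.
have /choice[xy hxy] : forall n : nat, exists p : R * R,
    [/\ a <= p.1 <= b, a <= p.2 <= b, `|p.1 - p.2| < n.+1%:R^-1 &
      eps <= `|f p.1 - f p.2|].
  move=> n; apply: contrapT => hp; apply: hn; exists (n.+1%:R^-1).
    by rewrite invr_gt0.
  move=> x y xab yab xyn; rewrite ltNge; apply/negP => hle.
  by apply: hp; exists (x, y).
have [U [UU hU]] := exists_ultrafilter_at_infinity.
have PU : ProperFilter U by exact: ultra_proper.
have [l hl] : exists l : R, (fun n => (xy n).1) @ U --> l.
  apply: (@ultra_bounded_cvg _ _ UU _ (`|a| + `|b|)) => n.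
  have [/andP[h1 h2] _ _ _] := hxy n; rewrite ler_norml.
  have := ler_norm b; have := lerNnormlW (lexx `|a|); have := normr_ge0 a.
  have := normr_ge0 b; move=> ? ? ? ?; apply/andP; split; lra.
have hy : (fun n => (xy n).2) @ U --> l.
  have h0 : (fun n => (xy n).1 - (xy n).2) @ U --> (0 : R).
    have hh : (fun n => n.+1%:R^-1 : R) @ U --> (0 : R).
      exact: (cvg_trans (cvg_app _ hU) (@cvg_harmonic R)).
    apply/cvgrPdist_lt => e e0; have /cvgrPdist_lt/(_ _ e0) := hh.
    apply: filterS => n; have [_ _ h _] := hxy n; rewrite !sub0r !normrN.
    by apply: le_lt_trans; rewrite ltW // (lt_le_trans h) // ler_norm.
  rewrite -[l]subr0; apply: (eq_cvg_to _ (cvgB hl h0)) => n.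
  by rewrite /= opprB addrC subrK.
have hf : (fun n => f (xy n).1 - f (xy n).2) @ U --> f l - f l.
  exact: (cvgB (cvg_comp _ _ hl (fc l)) (cvg_comp _ _ hy (fc l))).
rewrite subrr in hf; have /cvgrPdist_lt/(_ _ eps0) := hf.
move=> /filter_ex[n]; rewrite sub0r normrN.
by have [_ _ _ h] := hxy n; rewrite ltNge h.
Qed.

Lemma continuous_integrable (f : R -> R) (a b : R) : continuous f ->
  lebesgue_measure.-integrable `[a, b] (EFin \o f).
Proof.
move=> fc; apply: continuous_compact_integrable; first exact: segment_compact.
exact: continuous_subspaceT.
Qed.

(** Integrating from [c < a] makes the primitive differentiable at [a] too. *)
Lemma Rintegral_mean_value (f : R -> R) (c a b : R) : continuous f ->
  c < a -> a < b ->
  exists2 x : R, a <= x <= b &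
    \int[lebesgue_measure]_(t in `[c, b]) f t - \int[lebesgue_measure]_(t in `[c, a]) f t
      = f x * (b - a).
Proof.
move=> fc ca ab; pose F (x : R) := \int[lebesgue_measure]_(t in `[c, x]) f t.
have hF x : c < x -> is_derive x 1 F (f x).
  move=> cx; have xu : x < x + 1 by rewrite ltrDl.
  have [h1 h2] := continuous_FTC1_closed xu (continuous_integrable c (x + 1) fc) cx (fc x).
  exact: DeriveDef h1 (etrans (esym (derive1E F x)) h2).
have [x xab h] : exists2 x, x \in `]a, b[ & F b - F a = f x * (b - a).
  apply: MVT => //.
    by move=> x; rewrite in_itv /= => /andP[ax _]; apply: hF; exact: lt_trans ax.
  apply: derivable_within_continuous => x; rewrite in_itv /= => /andP[ax _].
  by have /hF[] : c < x by exact: lt_le_trans ax.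
by exists x => //; move: xab; rewrite in_itv /= => /andP[/ltW -> /ltW ->].
Qed.

Lemma Rintegral_itv_diff (f : R -> R) (c a b : R) : continuous f ->
  c < a -> a < b ->
  \int[lebesgue_measure]_(t in `[a, b]) f t =
  \int[lebesgue_measure]_(t in `[c, b]) f t - \int[lebesgue_measure]_(t in `[c, a]) f t.
Proof.
move=> fc ca ab; rewrite (@Rintegral_itvB _ f (BLeft c) (BRight b) a).
- rewrite Rintegral_itv_obnd_cbnd //.
  apply: integrableS (continuous_integrable a b fc) => //.
  by move=> x /=; rewrite !in_itv /= => /andP[/ltW -> ->].
- exact: continuous_integrable.
- by rewrite bnd_simp ltW.
- by rewrite bnd_simp ltW.
Qed.

(** The integral telescopes into values of [f] at intermediate points, each of
   which is close to the node of its interval. *)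
Lemma Riemann_sum_cvg (f : R -> R) (a b eps : R) : continuous f -> a < b -> 0 < eps ->
  exists n0 : nat, forall n, (n0 <= n)%N -> (0 < n)%N ->
   `|\sum_(k < n) f (a + (b - a) * k%:R / n%:R) * ((b - a) / n%:R)
      - \int[lebesgue_measure]_(t in `[a, b]) f t| <= eps.
Proof.
move=> fc ab eps0; have ba : 0 < b - a by rewrite subr_gt0.
have [d d0 hd] := continuous_uniformly a b fc (divr_gt0 eps0 ba).
have [n0 hn0] : exists n0 : nat, (b - a) / d < n0%:R.
  exists (Num.truncn ((b - a) / d)).+1; exact: truncnS_gt.
exists n0 => n n0n n_gt0; have nR : 0 < n%:R :> R by rewrite ltr0n.
pose c := a - 1; pose F (x : R) := \int[lebesgue_measure]_(t in `[c, x]) f t.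
pose x (k : nat) : R := a + (b - a) * k%:R / n%:R.
have xS k : x k.+1 - x k = (b - a) / n%:R.
  by rewrite /x -natr1; field; rewrite gt_eqF.
have x0 : x 0%N = a by rewrite /x mulr0 mul0r addr0.
have xn : x n = b by rewrite /x mulfK ?gt_eqF // addrC subrK.
have xle k : a <= x k by rewrite lerDl divr_ge0 ?mulr_ge0 // ltW.
have xge k : (k <= n)%N -> x k <= b.
  move=> kn; rewrite -xn /x lerD2l ler_pM2r ?invr_gt0 // ler_pM2l // ler_nat //.
have step_lt : (b - a) / n%:R < d.
  rewrite ltr_pdivrMr // -ltr_pdivrMl // mulrC.
  by apply: (lt_le_trans hn0); rewrite ler_nat.
have -> : \int[lebesgue_measure]_(t in `[a, b]) f t = F b - F a.
  by apply: Rintegral_itv_diff; rewrite // /c; lra.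
have -> : F b - F a = \sum_(k < n) (F (x k.+1) - F (x k)).
  by rewrite -(big_mkord xpredT (fun k => F (x k.+1) - F (x k))) telescope_sumr // x0 xn.
rewrite -sumrB; apply: (le_trans (ler_norm_sum _ _ _)).
have -> : eps = \sum_(k < n) eps / n%:R.
  by rewrite sumr_const card_ord -[RHS]mulr_natr divfK ?gt_eqF.
apply: ler_sum => k _; rewrite -/(x k).
have kn : (k < n)%N by [].
have [] := @Rintegral_mean_value f c (x k) (x k.+1) fc.
- by apply: lt_le_trans (xle k); rewrite /c; lra.
- by rewrite -subr_gt0 xS divr_gt0.
move=> y /andP[y1 y2]; rewrite -/(F _) -/(F _) xS => ->.
rewrite -mulrBl normrM (ger0_norm (ltW (divr_gt0 ba nR))) mulrA ler_pM2r ?invr_gt0 //.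
rewrite -ler_pdivlMr //; apply: ltW; apply: hd.
- by rewrite xle xge // ltnW.
- by rewrite (le_trans (xle k) y1) (le_trans y2) // xge.
have := xS k => hs; rewrite distrC ger0_norm ?subr_ge0 //; lra.
Qed.

End RealAnalysis.

(** * Trigonometric sums on a block *)

Section Exponential.
Variable R : realType.
Implicit Types (s t : R).

Lemma expiD s t : expi (s + t) = expi s * expi t.
Proof.
apply/eqP; rewrite eq_complex /= cosD sinD.
by apply/andP; split; apply/eqP; ring.
Qed.

Lemma expi0 : expi (0 : R) = 1.
Proof. by rewrite /expi cos0 sin0. Qed.

Lemma expiN t : expi (- t) = (expi t)^*.
Proof. by rewrite /expi cosN sinN. Qed.

Lemma normc_expi t : normc (expi t) = 1.
Proof. by rewrite /normc /= cos2Dsin2 sqrtr1. Qed.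

Lemma expiMn t n : expi (n%:R * t) = expi t ^+ n.
Proof.
elim: n => [|n IH]; first by rewrite mul0r expi0 expr0.
by rewrite -natr1 mulrDl mul1r expiD IH exprSr.
Qed.

Lemma expi_eq1 t : 0 < t < 2 * pi -> expi t != 1.
Proof.
move=> /andP[t0 t2]; rewrite eq_complex /= negb_and; apply/orP; left.
have s0 : 0 < sin (t / 2) by apply: sin_gt0_pi; apply/andP; split; lra.
have -> : cos t = 1 - 2 * sin (t / 2) ^+ 2.
  have {1}-> : t = t / 2 + t / 2 by field.
  by rewrite cosD; have := cos2Dsin2 (t / 2); nra.
rewrite lt_eqF // ltrBlDr ltrDl mulr_gt0 // exprn_gt0 //.
Qed.

Lemma sum_expi_eq0 (L d : nat) : (0 < d < L)%N ->
  \sum_(k < L) expi (d%:R * (2 * pi * k%:R / L%:R)) = 0 :> R[i].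
Proof.
move=> /andP[d0 dL].
have L0 : 0 < L%:R :> R by rewrite ltr0n (leq_trans d0) // ltnW.
pose z : R[i] := expi (d%:R * (2 * pi / L%:R)).
have hk k : expi (d%:R * (2 * pi * k%:R / L%:R)) = z ^+ k.
  by rewrite /z -expiMn; congr expi; field; rewrite gt_eqF.
have zL : z ^+ L = 1.
  rewrite -hk mulfK ?gt_eqF // expiMn.
  by rewrite (_ : expi _ = 1) ?expr1n // /expi mulr_natl cos2pi sin2pi.
have z1 : z != 1.
  apply: expi_eq1; have pi0 := pi_gt0 R; apply/andP; split.
    by rewrite !mulr_gt0 ?invr_gt0 // ltr0n.
  rewrite mulrCA gtr_pMr ?mulr_gt0 // ltr_pdivrMr // mul1r ltr_nat //.
under eq_bigr => k _ do rewrite hk.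
have := subrX1 z L; rewrite zL subrr => /esym/eqP.
by rewrite mulf_eq0 subr_eq0 (negbTE z1) => /eqP.
Qed.

(** The sample points of the symbol; the offset [- pi] makes them the nodes of a
   Riemann sum over [[- pi, pi]]. *)
Definition angle (L k : nat) : R := - pi + (pi - - pi) * k%:R / L%:R.

(** The offset of [angle] only contributes a factor of modulus 1, so the usual
   orthogonality of the characters of the integers mod [L] applies. *)
Lemma sum_expi_angle (L r r' : nat) : (r < L)%N -> (r' < L)%N ->
  \sum_(k < L) expi (r%:R * angle L k) * (expi (r'%:R * angle L k))^*
    = (L%:R * (r == r')%:R)%:C.
Proof.
wlog rr : r r' / (r' <= r)%N.
  move=> h rL rL'; have [rr|rr] := leqP r' r; first exact: h.
  have := h r' r (ltnW rr) rL' rL; rewrite eq_sym => /(congr1 (fun z : R[i] => z^*)) /=.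
  rewrite conjc_realE conjc_sum => <-; apply: eq_bigr => k _.
  by rewrite conjcM conjcE mulrC.
move=> rL rL'; have [<-|ne] := eqVneq r r'.
  rewrite (eq_bigr (fun=> 1)) => [|k _]; last first.
    by rewrite mulc_conj normc_expi expr1n.
  by rewrite sumr_const card_ord mulr1 -(rmorph_nat (real_complex R)).
rewrite mulr0; pose d := (r - r')%N.
have dL : (0 < d < L)%N.
  by rewrite subn_gt0 ltn_neqAle eq_sym ne rr (leq_ltn_trans (leq_subr _ _)).
rewrite (eq_bigr (fun k : 'I_L => expi (- (d%:R * pi)) *
    expi (d%:R * (2 * pi * k%:R / L%:R)))) => [|k _].
  by rewrite -mulr_sumr sum_expi_eq0 ?mulr0.
rewrite -expiN -!expiD; congr expi.
by rewrite /angle /d natrB //; ring.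
Qed.

(** Discrete Fourier transform of the first [L] terms of [u], without
   normalization: [Parseval] has the factor [L]. *)
Definition ft (L : nat) (u : nat -> R[i]) (t : R) : R[i] :=
  \sum_(r < L) u r * (expi (r%:R * t))^*.

Lemma Parseval L (u : nat -> R[i]) :
  \sum_(k < L) normc (ft L u (angle L k)) ^+ 2 =
    L%:R * \sum_(r < L) normc (u r) ^+ 2.
Proof.
suff : \sum_(k < L) (normc (ft L u (angle L k)) ^+ 2)%:C =
    L%:R%:C * \sum_(r < L) (normc (u r) ^+ 2)%:C :> R[i].
  by rewrite -!real_complex_sum -rmorphM => -[].
under eq_bigr => k _.
  rewrite -mulc_conj {2}/ft conjc_sum mulr_sumr.
  under eq_bigr => r' _ do rewrite conjcM conjcE mulr_suml.
  over.
rewrite /= exchange_big /=.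
under eq_bigr => r' _.
  rewrite exchange_big /=.
  under eq_bigr => r _.
    rewrite (eq_bigr (fun k : 'I_L => u r * (u r')^* *
        (expi (r'%:R * angle L k) * (expi (r%:R * angle L k))^*))); last first.
      by move=> k _; ring.
    rewrite -mulr_sumr sum_expi_angle //.
    over.
  rewrite /= (bigD1 r') //= big1 ?addr0 => [|r ne]; last first.
    rewrite (_ : (r' == r :> nat) = false) ?mulr0 ?mulr0 //.
    by rewrite eq_sym; exact: negbTE ne.
  rewrite eqxx mulr1 mulc_conj mulrC.
  over.
by rewrite -mulr_sumr.
Qed.

End Exponential.

(** * The Toeplitz model and its symbol *)

Section Toeplitz.
Variables (R : realType) (M : nat) (b : int -> R[i]).
Implicit Types (t : R).

Definition toeplitz (j k : nat) : R[i] :=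
  if near_diag M j k then b (k%:Z - j%:Z) else 0.

Lemma banded_toeplitz : banded M toeplitz.
Proof. by move=> j k; rewrite /toeplitz => /negbTE ->. Qed.

Definition coeff_norm : R := \sum_(m < (2 * M).+1) normc (b (m%:Z - M%:Z)).

Lemma coeff_norm_ge0 : 0 <= coeff_norm.
Proof. by apply: sumr_ge0 => m _; exact: normc_ge0. Qed.

Lemma normc_toeplitz_le j k : normc (toeplitz j k) <= coeff_norm.
Proof.
rewrite /toeplitz; case: ifP => [/andP[h1 h2]|_]; last by rewrite normc0E coeff_norm_ge0.
have mM : (k + M - j < (2 * M).+1)%N by lia.
rewrite /coeff_norm (bigD1 (Ordinal mM)) //=.
rewrite (_ : (k + M - j)%N%:Z - M%:Z = k%:Z - j%:Z); last by lia.
by rewrite lerDl; apply: sumr_ge0 => m _; exact: normc_ge0.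
Qed.

Lemma normc_symbol_le t : normc (symbol M b t) <= coeff_norm.
Proof.
rewrite (le_trans (normc_sum _ _ _)) //; apply: ler_sum => m _.
by rewrite normcM normc_expi mulr1.
Qed.

Lemma toeplitz_column (L k : nat) t : (M <= k)%N -> (k + M < L)%N ->
  \sum_(r < L) toeplitz r k * (expi (r%:R * t))^* =
    symbol M b t * (expi (k%:R * t))^*.
Proof.
move=> Mk kL; pose F r := toeplitz r k * (expi (r%:R * t))^*.
have F0 r : ~~ near_diag M r k -> F r = 0.
  by move=> h; rewrite /F banded_toeplitz // mul0r.
(* Only the rows [k - M], ..., [k + M] contribute; they are listed backwards,
   since the row [k + M - m] carries the coefficient of index [m - M]. *)
rewrite -(big_mkord xpredT F) (big_cat_nat (n := (k - M)%N)) //=; last by lia.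
rewrite big1_seq ?add0r; last first.
  by move=> r; rewrite mem_index_iota => h; apply: F0; rewrite /near_diag; lia.
rewrite (big_cat_nat (n := (k + M).+1)) //=; last by lia.
rewrite [X in _ + X]big1_seq ?addr0; last first.
  by move=> r; rewrite mem_index_iota => h; apply: F0; rewrite /near_diag; lia.
rewrite -{1}[(k - M)%N]add0n big_addn.
have -> : ((k + M).+1 - (k - M))%N = (2 * M).+1 by lia.
rewrite big_mkord (reindex_inj rev_ord_inj) /= /symbol mulr_suml.
apply: eq_bigr => m _; have m2 : (m <= 2 * M)%N by rewrite -ltnS.
have -> : ((2 * M).+1 - m.+1 + (k - M))%N = (k + M - m)%N by lia.
rewrite /F /toeplitz (_ : near_diag _ _ _); last by rewrite /near_diag; lia.
have -> : k%:Z - (k + M - m)%N%:Z = m%:Z - M%:Z by lia.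
rewrite -mulrA; congr (_ * _); rewrite -!expiN -expiD; congr expi.
rewrite natrB ?natrD; last by lia.
rewrite rmorphB /=; ring.
Qed.

(** The image of a vector supported at distance at least [M] from both ends of the
   block stays inside the block, so that the Toeplitz matrix acts on it as a
   convolution and the Fourier transform diagonalizes it exactly. *)
Lemma ft_toeplitz (L : nat) (y : nat -> R[i]) t :
  (forall k, (k < L)%N -> ~~ ((M <= k) && (k + M < L))%N -> y k = 0) ->
  ft L (fun r => \sum_(k < L) toeplitz r k * y k) t = symbol M b t * ft L y t.
Proof.
move=> hy; rewrite /ft mulr_sumr.
under eq_bigr => r _ do rewrite mulr_suml.
rewrite exchange_big /=; apply: eq_bigr => k _.
have [/andP[h1 h2]|/hy ->] := boolP ((M <= k) && (k + M < L))%N; last 1 first.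
- by rewrite ltn_ord.
- rewrite (eq_bigr (fun r : 'I_L => y k * (toeplitz r k * (expi (r%:R * t))^*))).
    by rewrite -mulr_sumr toeplitz_column // mulrCA.
  by move=> r _; ring.
- by rewrite mul0r mulr0 big1 // => r _; rewrite mulr0 mul0r.
Qed.

Lemma toeplitz_block (L : nat) (y : nat -> R[i]) :
  (forall k, (k < L)%N -> ~~ ((M <= k) && (k + M < L))%N -> y k = 0) ->
  L%:R * \sum_(r < L) normc (\sum_(k < L) toeplitz r k * y k) ^+ 2 =
  \sum_(i < L) normc (symbol M b (angle R L i)) ^+ 2 *
     normc (ft L y (angle R L i)) ^+ 2.
Proof.
move=> hy; rewrite -(Parseval L (fun r => \sum_(k < L) toeplitz r k * y k)).
by apply: eq_bigr => i _; rewrite ft_toeplitz // normcM exprMn.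
Qed.

Lemma continuous_symbol : continuous (fun t => normc (symbol M b t)).
Proof.
move=> t; apply: (@cvg_normc _ _ (nbhs t) _ (fun u : R => symbol M b u : R[i]^o)).
have h n : (fun u : R => \sum_(k < n) b (k%:Z - M%:Z) *
      expi ((k%:Z - M%:Z)%:~R * u) : R[i]^o) @ t -->
    (\sum_(k < n) b (k%:Z - M%:Z) * expi ((k%:Z - M%:Z)%:~R * t) : R[i]^o).
  elim: n => [|n IH].
    by rewrite big_ord0; apply: (eq_cvg_to _ (cvg_cst _)) => u; rewrite big_ord0.
  have hc : (fun u : R => (n%:Z - M%:Z)%:~R * u) @ t --> (n%:Z - M%:Z)%:~R * t.
    by apply: cvgM; [exact: cvg_cst|exact: cvg_id].
  have he : (fun u : R => expi ((n%:Z - M%:Z)%:~R * u) : R[i]^o) @ t -->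
      (expi ((n%:Z - M%:Z)%:~R * t) : R[i]^o).
    apply: cvg_ReIm => /=.
      exact: (cvg_comp _ _ hc (@continuous_cos R _)).
    exact: (cvg_comp _ _ hc (@continuous_sin R _)).
  rewrite big_ord_recr /=.
  apply: (eq_cvg_to _ (cvgcD IH (cvgcM (c := b (n%:Z - M%:Z)) he))) => u.
  by rewrite big_ord_recr.
exact: h.
Qed.

End Toeplitz.

Lemma sum_blocks (V : nmodType) (Q L : nat) (F : nat -> V) :
  \sum_(k < Q * L) F k = \sum_(p < Q) \sum_(r < L) F (p * L + r)%N.
Proof.
elim: Q => [|Q IH]; first by rewrite mul0n !big_ord0.
rewrite big_ord_recr /= -IH mulSn addnC.
rewrite -!(big_mkord xpredT F) (big_cat_nat (n := (Q * L)%N)) ?leq_addr //=.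
congr (_ + _); rewrite -{1}[(Q * L)%N]add0n big_addn addKn big_mkord.
by apply: eq_bigr => r _; rewrite addnC.
Qed.

(** * Comparison with the block model *)

Lemma sum_ord_support (V : nmodType) (F : nat -> V) (m n : nat) : (m <= n)%N ->
  (forall k, (m <= k)%N -> F k = 0) -> \sum_(k < n) F k = \sum_(k < m) F k.
Proof.
move=> mn F0; rewrite -!(big_mkord xpredT F) (big_cat_nat (n := m)) //=.
rewrite [X in _ + X]big1_seq ?addr0 // => k /andP[_].
by rewrite mem_index_iota => /andP[mk _]; exact: F0.
Qed.

Section BlockModel.
Variables (R : realType) (M : nat) (b : int -> R[i]) (a : nat -> nat -> R[i]).
Variables (c : R) (w : nat -> R) (L Q P1 : nat) (d : R).
Hypotheses (ha : banded M a) (hc : bounded_entries a c) (L_gt0 : (0 < L)%N).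
Hypothesis w_ge0 : forall p, 0 <= w p.
Hypothesis d_ge0 : 0 <= d.
Hypothesis close : forall p r j, (P1 <= p < Q)%N -> (r < L)%N ->
  normc (a j (p * L + r) - (w p)%:C * toeplitz M b j (p * L + r)) <= d.
Hypothesis small : forall j k, (Q * L <= k)%N -> normc (a j k) <= d.
Implicit Types (x : l2 R).

Let beta i := normc (symbol M b (angle R L i)).

(** The weights are frozen on each block of length [L], and there are [Q] blocks. *)
Definition model j k : R[i] :=
  if (k < Q * L)%N then (w (k %/ L))%:C * toeplitz M b j k else 0.

Lemma modelE j p r : (p < Q)%N -> (r < L)%N ->
  model j (p * L + r) = (w p)%:C * toeplitz M b j (p * L + r).
Proof.
move=> pQ rL; rewrite /model divnMDl // divn_small // addn0 ifT //.
by apply: (@leq_trans (p.+1 * L)); rewrite ?leq_mul2r ?pQ ?orbT // mulSn; lia.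
Qed.

Lemma banded_model : banded M model.
Proof.
by move=> j k h; rewrite /model banded_toeplitz // mulr0; case: ifP.
Qed.

Definition interior (r : nat) := ((M <= r) && (r + M < L))%N.

(** The vectors on which [matrix_op a] is close to the model: they vanish on the
   first [P1] blocks and near the boundaries of the first [Q] blocks, so that
   the model does not couple different blocks. *)
Definition block_supported x :=
  (forall k, (k < P1 * L)%N -> x k = 0) /\
  (forall p r, (p < Q)%N -> (r < L)%N -> ~~ interior r -> x (p * L + r)%N = 0).

Lemma bounded_model : exists C, bounded_entries model C.
Proof.
have W0 : 0 <= \sum_(p < Q) w p by apply: sumr_ge0.
exists ((\sum_(p < Q) w p) * coeff_norm M b) => j k.
rewrite /model; case: ifP => [kQ|_]; last by rewrite normc0E mulr_ge0 ?coeff_norm_ge0.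
rewrite normcM normc_real ger0_norm // ler_pM ?normc_ge0 ?normc_toeplitz_le //.
have pQ : (k %/ L < Q)%N by rewrite ltn_divLR.
rewrite (bigD1 (Ordinal pQ)) //= lerDl; exact: sumr_ge0.
Qed.

Lemma l2norm_diff_model x : block_supported x ->
  l2norm (matrix_op a x - matrix_op model x) <= (2 * M).+1%:R * d * l2norm x.
Proof.
move=> [hx1 hx2]; have [C hC] := bounded_model.
pose E j k := a j k - model j k.
have hE : banded M E by move=> j k h; rewrite /E ha // banded_model // subrr.
have hEc : bounded_entries E (c + C).
  by move=> j k; rewrite (le_trans (normcD _ _)) // normc_opp lerD.
have -> : matrix_op a x - matrix_op model x = matrix_op E x.
  apply: l2_ext => j; apply: esym; apply: etrans (matrix_opE hE hEc x j) _.
  apply: (etrans _ (congr2 (fun u v => u - v) (esym (matrix_opE ha hc x j))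
    (esym (matrix_opE banded_model hC x j)))).
  rewrite /band_mul -sumrB; apply: eq_bigr => k _; exact: mulrBl.
apply: (matrix_op_bound hE hEc) => // j k.
have [kQ|Qk] := ltnP k (Q * L); last first.
  rewrite normcM ler_wpM2r ?normc_ge0 // /E /model ltnNge Qk subr0.
  exact: small.
have [k1|k1] := ltnP k (P1 * L); first by rewrite hx1 // mulr0 normc0E mulr0.
have pQ : (k %/ L < Q)%N by rewrite ltn_divLR.
have pP1 : (P1 <= k %/ L)%N by rewrite leq_divRL.
have rL : (k %% L < L)%N by rewrite ltn_mod.
rewrite normcM ler_wpM2r ?normc_ge0 // /E (divn_eq k L) modelE //.
by apply: close; rewrite // pP1.
Qed.

Lemma toeplitz_shift p r r' :
  toeplitz M b (p * L + r) (p * L + r') = toeplitz M b r r'.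
Proof.
rewrite /toeplitz (_ : near_diag M (p * L + r) (p * L + r') = near_diag M r r').
  by case: ifP => // _; congr b; lia.
by rewrite /near_diag; apply/idP/idP; lia.
Qed.

Let blk x p r := x (p * L + r)%N.

Lemma model_block x p r : block_supported x -> (p < Q)%N -> (r < L)%N ->
  matrix_op model x (p * L + r)%N =
    (w p)%:C * \sum_(r' < L) toeplitz M b r r' * blk x p r'.
Proof.
move=> [hx1 hx2] pQ rL; have [C hC] := bounded_model.
set j := (p * L + r)%N.
rewrite (matrix_opE banded_model hC).
rewrite -(band_mul_widen x banded_model (n := (Q * L + (j + M).+1)%N)); last first.
  by rewrite ltn_addl.
rewrite (sum_ord_support (F := fun k => model j k * x k) (m := (Q * L)%N)) ?leq_addr //; last first.
  by move=> k Qk; rewrite /model ltnNge Qk mul0r.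
rewrite (sum_blocks _ _ (fun k => model j k * x k)) (bigD1 (Ordinal pQ)) //=.
rewrite [X in _ + X]big1 ?addr0 => [|q qp]; last first.
  rewrite big1 // => r' _; have [ri|rn] := boolP (interior r').
    2: by rewrite hx2 ?mulr0.
  rewrite banded_model ?mul0r // /near_diag /j.
  have : (q < p)%N || (p < q)%N.
    by rewrite -neq_ltn; apply: contraNneq qp => qp; apply/eqP/val_inj.
  move: ri => /andP[r1 r2]; have r'L := ltn_ord r'.
  move=> /orP[qp1|pq]; rewrite negb_and -!ltnNge; apply/orP; [left|right].
    have : (q.+1 * L <= p * L)%N by rewrite leq_mul2r qp1 orbT.
    by rewrite mulSn; lia.
  have : (p.+1 * L <= q * L)%N by rewrite leq_mul2r pq orbT.
  by rewrite mulSn; lia.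
rewrite mulr_sumr; apply: eq_bigr => r' _.
by rewrite modelE // toeplitz_shift mulrA.
Qed.

Lemma model_outside x j : block_supported x -> (Q * L <= j)%N ->
  matrix_op model x j = 0.
Proof.
move=> [hx1 hx2] Qj; have [C hC] := bounded_model.
rewrite (matrix_opE banded_model hC) /band_mul big1 // => k _.
have [kQ|Qk] := ltnP k (Q * L); last by rewrite /model ltnNge Qk mul0r.
have [near|/banded_model ->] := boolP (near_diag M j k); last by rewrite mul0r.
have pQ : (k %/ L < Q)%N by rewrite ltn_divLR.
have rL : (k %% L < L)%N by rewrite ltn_mod.
rewrite [in x _](divn_eq k L) hx2 ?mulr0 // negb_and -leqNgt.
apply/orP; right; move: near => /andP[h1 h2].
have : ((k %/ L).+1 * L <= Q * L)%N by rewrite leq_mul2r pQ orbT.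
rewrite mulSn; have := divn_eq k L; lia.
Qed.

(** In Fourier coordinates the model multiplies by [w p * beta i], up to a factor of
   modulus 1. *)
Lemma sqr_l2norm_model x : block_supported x ->
  L%:R * l2norm (matrix_op model x) ^+ 2 =
  \sum_(p < Q) \sum_(i < L) (w p * beta i) ^+ 2 *
     normc (ft L (blk x p) (angle R L i)) ^+ 2.
Proof.
move=> hx; set v := matrix_op model x.
have -> : v = trunc (Q * L) v.
  apply: l2_ext => j; rewrite truncE; case: ltnP => // Qj.
  exact: model_outside.
rewrite sqr_l2norm_trunc (sum_blocks _ _ (fun k => normc (v k) ^+ 2)) mulr_sumr.
apply: eq_bigr => p _.
under eq_bigr => r _ do rewrite model_block // normcM normc_real ger0_norm // exprMn.
have hb k : (k < L)%N -> ~~ ((M <= k) && (k + M < L))%N -> blk x p k = 0.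
  by move=> kL; exact: (proj2 hx).
rewrite -mulr_sumr mulrCA (@toeplitz_block R M b L (blk x p) hb).
by rewrite mulr_sumr; apply: eq_bigr => i _; rewrite exprMn mulrA.
Qed.

Lemma sqr_l2norm_blocks x :
  L%:R * \sum_(k < Q * L) normc (x k) ^+ 2 =
  \sum_(p < Q) \sum_(i < L) normc (ft L (blk x p) (angle R L i)) ^+ 2.
Proof.
rewrite (sum_blocks _ _ (fun k => normc (x k) ^+ 2)) mulr_sumr.
by apply: eq_bigr => p _; rewrite Parseval.
Qed.

(** Functionals enforcing [block_supported] and, in addition, the vanishing of
   the Fourier coefficients selected by [B]. *)
Definition constraint (B : pred ('I_Q * 'I_L))
    (i : ('I_(P1 * L) + 'I_Q * ('I_M + 'I_M) + {u : 'I_Q * 'I_L | B u})%type) : l2 R :=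
  match i with
  | inl (inl k) => delta R k
  | inl (inr (p, inl r)) => delta R (p * L + r)%N
  | inl (inr (p, inr r)) => delta R (p * L + (L - r.+1))%N
  | inr u => \sum_(r < L) expi (r%:R * angle R L (val u).2)
               *: delta R ((val u).1 * L + r)%N
  end.
Arguments constraint : clear implicits.

Lemma card_constraint (B : pred ('I_Q * 'I_L)) :
  #|{: 'I_(P1 * L) + 'I_Q * ('I_M + 'I_M) + {u : 'I_Q * 'I_L | B u}}| =
  (P1 * L + Q * (2 * M) + #|B|)%N.
Proof.
by rewrite !card_sum card_prod card_sum !card_ord card_sig addnn -mul2n.
Qed.

Lemma constraintP (B : pred ('I_Q * 'I_L)) x :
  (forall i, dot x (constraint B i) = 0) -> block_supported x /\
  forall p i, B (p, i) -> ft L (blk x p) (angle R L i) = 0.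
Proof.
move=> h; split; first split.
- by move=> k kP; have := h (inl (inl (Ordinal kP))); rewrite dot_delta.
- move=> p r pQ rL; rewrite negb_and => /orP[rM|rM].
    rewrite -ltnNge in rM.
    by have := h (inl (inr (Ordinal pQ, inl (Ordinal rM)))); rewrite dot_delta.
  have rM' : (L - r.+1 < M)%N by lia.
  have := h (inl (inr (Ordinal pQ, inr (Ordinal rM')))); rewrite dot_delta /=.
  by rewrite (_ : (L - (L - r.+1).+1 = r)%N); last by lia.
move=> p i Bpi; have := h (inr (exist _ (p, i) Bpi)) => /= <-.
by rewrite dot_sumr /ft; apply: eq_bigr => r _; rewrite dotZr dot_delta mulrC.
Qed.

Lemma model_le x (t : R) : 0 <= t -> block_supported x ->
  (forall (p : 'I_Q) (i : 'I_L), t < w p * beta i ->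
     ft L (blk x p) (angle R L i) = 0) ->
  l2norm (matrix_op model x) <= t * l2norm x.
Proof.
move=> t0 hx hft; have LR : 0 < L%:R :> R by rewrite ltr0n.
rewrite -(@ler_pXn2r _ 2) ?nnegrE ?mulr_ge0 ?l2norm_ge0 //.
rewrite -(ler_pM2l LR) sqr_l2norm_model // exprMn.
apply: (@le_trans _ _ (L%:R * (t ^+ 2 * \sum_(k < Q * L) normc (x k) ^+ 2))).
  rewrite mulrCA sqr_l2norm_blocks mulr_sumr; apply: ler_sum => p _.
  rewrite mulr_sumr; apply: ler_sum => i _.
  have [h|/hft ->] := leP (w p * beta i) t; last by rewrite normc0E expr0n !mulr0.
  by rewrite ler_wpM2r ?sqr_ge0 // ler_pXn2r ?nnegrE ?mulr_ge0 ?normc_ge0.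
by rewrite ler_pM2l // ler_wpM2l ?sqr_ge0 // l2norm_sum_le.
Qed.

Lemma model_ge x (t : R) : 0 <= t -> block_supported x ->
  (forall k, (Q * L <= k)%N -> x k = 0) ->
  (forall (p : 'I_Q) (i : 'I_L), w p * beta i < t ->
     ft L (blk x p) (angle R L i) = 0) ->
  t * l2norm x <= l2norm (matrix_op model x).
Proof.
move=> t0 hx hx0 hft; have LR : 0 < L%:R :> R by rewrite ltr0n.
rewrite -(@ler_pXn2r _ 2) ?nnegrE ?mulr_ge0 ?l2norm_ge0 //.
rewrite -(ler_pM2l LR) sqr_l2norm_model // exprMn.
have -> : l2norm x ^+ 2 = \sum_(k < Q * L) normc (x k) ^+ 2.
  rewrite -sqr_l2norm_trunc; congr (l2norm _ ^+ 2); apply: l2_ext => k.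
  by rewrite truncE; case: ltnP => // /hx0.
rewrite mulrCA sqr_l2norm_blocks mulr_sumr; apply: ler_sum => p _.
rewrite mulr_sumr; apply: ler_sum => i _.
have [h|/hft ->] := leP t (w p * beta i); last by rewrite normc0E expr0n !mulr0.
by rewrite ler_wpM2r ?sqr_ge0 // ler_pXn2r ?nnegrE ?mulr_ge0 ?normc_ge0.
Qed.

Variable e : nat -> l2 R.
Hypothesis he : forall n,
  [/\ l2norm (e n) = 1, forall i, (i < n)%N -> dot (e n) (e i) = 0 &
    forall x, (forall i, (i < n)%N -> dot x (e i) = 0) ->
      l2norm (matrix_op a x) <= l2norm (matrix_op a (e n)) * l2norm x].

(** The vectors satisfying the constraints have a codimension at most [n], and the
   operator is bounded by [t + (2 M + 1) d] there. *)
Lemma singular_le_count (t : R) n : 0 <= t ->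
  (P1 * L + Q * (2 * M) + #|[pred u : 'I_Q * 'I_L | (t < w u.1 * beta u.2)%R]| <= n)%N ->
  l2norm (matrix_op a (e n)) <= t + (2 * M).+1%:R * d.
Proof.
move=> t0 hn.
apply: (singular_le (matrix_opD ha hc) (matrix_opZ ha hc) he
  (g := constraint [pred u : 'I_Q * 'I_L | t < w u.1 * beta u.2])).
- by rewrite addr_ge0 ?mulr_ge0.
- by rewrite card_constraint.
move=> x /constraintP[hx hft].
have -> : matrix_op a x = matrix_op model x + (matrix_op a x - matrix_op model x).
  by rewrite addrC subrK.
apply: (le_trans (l2normD _ _)); rewrite mulrDl; apply: lerD; last first.
  exact: l2norm_diff_model.
by apply: model_le => // p i h; exact: hft.
Qed.

(** Dually, among the vectors supported by the first [Q] blocks the constraints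
   leave a subspace of dimension larger than [n]. *)
Lemma singular_ge_count (t : R) n : 0 <= t ->
  (P1 * L + Q * (2 * M) + #|[pred u : 'I_Q * 'I_L | (w u.1 * beta u.2 < t)%R]| + n
     < Q * L)%N ->
  t - (2 * M).+1%:R * d <= l2norm (matrix_op a (e n)).
Proof.
move=> t0 hn.
apply: (singular_ge (e := e) he (N := (Q * L)%N)
  (g := constraint [pred u : 'I_Q * 'I_L | w u.1 * beta u.2 < t])).
  by rewrite card_constraint.
move=> x hx0 /constraintP[hx hft]; rewrite mulrBl lerBlDr.
have h1 : t * l2norm x <= l2norm (matrix_op model x).
  by apply: model_ge => // p i h; exact: hft.
apply: (le_trans h1).
have {1}-> : matrix_op model x = matrix_op a x - (matrix_op a x - matrix_op model x).
  by rewrite opprB addrC subrK.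
by rewrite (le_trans (l2normB _ _)) // lerD2l l2norm_diff_model.
Qed.

End BlockModel.

(** * Asymptotics of the entries *)

Section Entries.
Variables (R : realType) (gamma : R) (M : nat) (b : int -> R[i]).
Variable a : nat -> nat -> R[i].
Hypothesis gamma_gt0 : 0 < gamma.
Hypothesis a_band : banded M a.
Hypothesis a_diag : forall m : int, (absz m <= M)%N -> forall eps : R, 0 < eps ->
  exists N : nat, forall j, (N <= j)%N ->
    normc (a j (absz (j%:Z + m)) - b m * (j%:R `^ (- gamma))%:C)
      <= eps * j%:R `^ (- gamma).

Local Notation bmax := (coeff_norm M b).

Lemma entries_cvg (eps : R) : 0 < eps -> exists J : nat, forall j k, (J <= k)%N ->
  near_diag M j k ->
  normc (a j k - toeplitz M b j k * (j%:R `^ (- gamma))%:C) <= eps * j%:R `^ (- gamma).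
Proof.
move=> eps0.
have /choice[N hN] : forall m : 'I_(2 * M).+1, exists N : nat, forall j, (N <= j)%N ->
    normc (a j (absz (j%:Z + (m%:Z - M%:Z))) -
      b (m%:Z - M%:Z) * (j%:R `^ (- gamma))%:C) <= eps * j%:R `^ (- gamma).
  by move=> m; apply: a_diag => //; have := ltn_ord m; lia.
exists (\sum_m N m + M)%N => j k Jk near.
have /andP[h1 h2] := near.
have mM : (k + M - j < (2 * M).+1)%N by lia.
have := hN (Ordinal mM) j; rewrite /= (_ : (k + M - j)%N%:Z - M%:Z = k%:Z - j%:Z); last by lia.
rewrite (_ : absz (j%:Z + (k%:Z - j%:Z)) = k); last by lia.
rewrite /toeplitz near; apply.
have : (N (Ordinal mM) <= \sum_m N m)%N by rewrite (bigD1 (Ordinal mM)) //= leq_addr.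
lia.
Qed.

Lemma powRN_le1 (j : nat) : j%:R `^ (- gamma) <= 1 :> R.
Proof.
have [->|j0] := posnP j; first by rewrite powR0 // oppr_eq0 gt_eqF.
rewrite powRN invf_le1 ?powR_gt0 ?ltr0n //.
have p1 : (1 : R) `^ gamma = 1 by rewrite powR1.
rewrite -[leLHS]p1; apply: ge0_ler_powR; rewrite ?nnegrE ?ler1n //.
exact: ltW.
Qed.

Lemma entries_bounded : exists c, bounded_entries a c.
Proof.
have [J hJ] := entries_cvg ltr01.
pose c0 := \sum_(k < J) \sum_(j < J + M) normc (a j k).
have c00 : 0 <= c0.
  by apply: sumr_ge0 => k _; apply: sumr_ge0 => j _; exact: normc_ge0.
exists (c0 + (1 + bmax)) => j k.
have [near|/a_band ->] := boolP (near_diag M j k); last first.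
  by rewrite normc0E !addr_ge0 ?coeff_norm_ge0.
have /andP[h1 h2] := near.
have [kJ|Jk] := ltnP k J.
  apply: (@le_trans _ _ c0); last by rewrite lerDl addr_ge0 ?coeff_norm_ge0.
  have jJ : (j < J + M)%N by lia.
  rewrite /c0 (bigD1 (Ordinal kJ)) //= (bigD1 (Ordinal jJ)) //= -addrA lerDl addr_ge0 //.
    by apply: sumr_ge0 => i _; exact: normc_ge0.
  by apply: sumr_ge0 => i _; apply: sumr_ge0 => i' _; exact: normc_ge0.
apply: (@le_trans _ _ (1 + bmax)); last by rewrite lerDr.
have := hJ _ _ Jk near; rewrite mul1r => h.
rewrite -[a j k](subrK (toeplitz M b j k * (j%:R `^ (- gamma))%:C)).
have p1 := powRN_le1 j; have p0 : 0 <= j%:R `^ (- gamma) :> R by exact: powR_ge0.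
rewrite (le_trans (normcD _ _)) // lerD ?(le_trans h) //.
rewrite normcM normc_real ger0_norm //.
rewrite -[leRHS]mulr1; apply: ler_pM; rewrite ?normc_ge0 //.
exact: normc_toeplitz_le.
Qed.

(** The value of [j `^ (- gamma)] at the right end of the block [p]; the left end
   would be the index 0 when [p = 0]. *)
Definition weight (L p : nat) : R := (p.+1 * L)%N%:R `^ (- gamma).

Lemma weight_ge0 L p : 0 <= weight L p. Proof. exact: powR_ge0. Qed.

Lemma powRN_anti (x y : R) : 0 < x -> x <= y -> y `^ (- gamma) <= x `^ (- gamma).
Proof.
move=> x0 xy; have y0 := lt_le_trans x0 xy.
rewrite !powRN lef_pV2 ?posrE ?powR_gt0 //.
by apply: ge0_ler_powR; rewrite ?nnegrE ?(ltW gamma_gt0) ?(ltW x0) ?(ltW y0).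
Qed.

Lemma weight_nonincreasing L p q : (0 < L)%N -> (p <= q)%N -> weight L q <= weight L p.
Proof.
move=> L0 pq; apply: powRN_anti; first by rewrite ltr0n muln_gt0 L0.
by rewrite ler_nat leq_mul2r ltnS pq orbT.
Qed.

Lemma powR_near1 (eps : R) : 0 < eps -> exists2 d : R, 0 < d &
  forall x, 0 <= x -> `|x - 1| < d -> `|x `^ gamma - 1| <= eps.
Proof.
move=> eps0.
have h : (fun x : R => `|x| `^ gamma) @ (1 : R) --> (1 : R) `^ gamma.
  apply: cvg_powR => //; rewrite -{2}[1](@normr1 R).
  exact: norm_continuous.
rewrite powR1 /= in h; have /cvgrPdist_le/(_ _ eps0)/nbhs_ballP[d /= d0 hd] := h.
exists d => // x x0 xd; have : ball (1 : R) d x by rewrite /ball /= distrC.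
by move=> /hd /=; rewrite (ger0_norm x0) distrC.
Qed.

(** As the length [L] is fixed, the ratio of two indices within [M] of the block
   [p] tends to 1 when [p] grows. *)
Lemma weight_close (L : nat) (eps : R) : (0 < L)%N -> 0 < eps ->
  exists P0 : nat, forall p r j, (P0 <= p)%N -> (r < L)%N ->
    near_diag M j (p * L + r) ->
    (0 < j)%N /\ `|j%:R `^ (- gamma) - weight L p| <= eps * weight L p.
Proof.
move=> L0 eps0; have [d d0 hd] := powR_near1 eps0.
(* [j] lies within [L + M] of the right end of the block. *)
pose n := Num.truncn ((L + M)%N%:R / d).
exists (M + n).+1 => p r j Pp rL /andP[h1 h2].
have pL : (p <= p * L)%N by rewrite leq_pmulr.
have j0 : (n < j)%N by lia.
split; first by exact: leq_ltn_trans j0.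
have jR : 0 < j%:R :> R by rewrite ltr0n (leq_ltn_trans _ j0).
have w0 : 0 < weight L p by rewrite powR_gt0 // ltr0n muln_gt0 L0.
have e1 : j%:R `^ (- gamma) = weight L p * ((p.+1 * L)%N%:R / j%:R) `^ gamma.
  rewrite /weight powRM ?invr_ge0 ?ler0n // mulrA !powRN mulVf ?mul1r.
    by rewrite -[X in _ = X `^ _]powR_inv1 ?ler0n // -powRrM mulN1r powRN.
  by rewrite gt_eqF // powR_gt0 // ltr0n muln_gt0 L0.
rewrite e1 -{2}[weight L p]mulr1 -mulrBr normrM (gtr0_norm w0) mulrC ler_pM2r //.
apply: hd; first by rewrite divr_ge0.
have -> : (p.+1 * L)%N%:R / j%:R - 1 = ((p.+1 * L)%N%:R - j%:R) / j%:R :> R.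
  by rewrite mulrBl divff ?gt_eqF.
rewrite normrM.
rewrite [`|j%:R^-1|]gtr0_norm ?invr_gt0 // ltr_pdivrMr //.
apply: (@le_lt_trans _ _ (L + M)%N%:R).
  rewrite ler_norml lerBrDl lerBlDl; apply/andP; split.
    by rewrite -natrD ler_nat mulSn; lia.
  by rewrite lerBlDr -natrD ler_nat mulSn; lia.
rewrite -ltr_pdivrMl // mulrC.
by rewrite (lt_le_trans (truncnS_gt _)) // ler_nat.
Qed.

Lemma block_close (L : nat) (eps : R) : (0 < L)%N -> 0 < eps ->
  exists P0 : nat, forall p r j, (P0 <= p)%N -> (r < L)%N ->
    normc (a j (p * L + r) - (weight L p)%:C * toeplitz M b j (p * L + r))
      <= eps * weight L p.
Proof.
move=> L0 eps0.
pose e1 := Num.min 1 (eps / (2 + bmax)).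
have B2 : 0 < 2 + bmax by rewrite ltr_pwDl ?coeff_norm_ge0.
have e10 : 0 < e1 by rewrite lt_min ltr01 divr_gt0.
have e11 : e1 <= 1 by rewrite ge_min lexx.
have e1e : e1 * (2 + bmax) <= eps.
  by rewrite -ler_pdivlMr // ge_min lexx orbT.
have [J hJ] := entries_cvg e10; have [P0 hP0] := weight_close L0 e10.
exists (P0 + J)%N => p r j Pp rL.
have [near|far] := boolP (near_diag M j (p * L + r)); last first.
  rewrite a_band // banded_toeplitz // mulr0 subrr normc0E.
  by rewrite mulr_ge0 ?weight_ge0 // ltW.
have [j0 hw] := hP0 p r j (leq_trans (leq_addr _ _) Pp) rL near.
have Jk : (J <= p * L + r)%N.
  have : (p <= p * L)%N by rewrite leq_pmulr.
  lia.
have ha := hJ _ _ Jk near.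
set k := (p * L + r)%N in ha near *; set z := toeplitz M b j k in ha *.
set w := weight L p in hw *; set v := j%:R `^ (- gamma) in ha hw.
have w0 : 0 <= w by exact: weight_ge0.
have -> : a j k - w%:C * z = (a j k - z * v%:C) + (v - w)%:C * z.
  rewrite rmorphB /=; ring.
apply: (le_trans (normcD _ _)).
have vw : v <= 2 * w.
  by have := le_trans (ler_norm _) hw; have := ler_wpM2r w0 e11; lra.
have t1 : normc (a j k - z * v%:C) <= e1 * (2 * w).
  by apply: (le_trans ha); rewrite ler_wpM2l // ltW.
have t2 : normc ((v - w)%:C * z) <= e1 * w * bmax.
  rewrite normcM normc_real; apply: ler_pM => //; rewrite ?normc_ge0 //.
  exact: normc_toeplitz_le.
have t3 := ler_wpM2r w0 e1e.
apply: (le_trans (lerD t1 t2)); apply: le_trans t3.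
by rewrite le_eqVlt; apply/orP; left; apply/eqP; ring.
Qed.

End Entries.

(** * Counting the singular values of the model *)

Section Counting.
Variable R : realType.

Lemma card_ord_interval (Q m n : nat) (P : pred 'I_Q) :
  (forall p, P p -> (m <= p < n)%N) -> (#|P| <= n - m)%N.
Proof.
move=> h; rewrite cardE -(size_map val) -(size_iota m (n - m)).
apply: uniq_leq_size; first by rewrite map_inj_uniq ?enum_uniq //; exact: val_inj.
move=> _ /mapP[p + ->]; rewrite mem_enum => /h.
by rewrite mem_iota /=; lia.
Qed.

Lemma card_succ_lt (Q : nat) (x : R) : 0 <= x ->
  #|[pred p : 'I_Q | p.+1%:R < x]|%:R <= x.
Proof.
move=> x0; apply: (@le_trans _ _ (Num.truncn x)%:R); last by rewrite truncn_le.
rewrite ler_nat -[leqRHS]subn0; apply: card_ord_interval => p /= px.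
by rewrite truncn_gt_nat ltW.
Qed.

Lemma card_succ_gt (Q : nat) (x : R) : 0 <= x <= Q%:R ->
  #|[pred p : 'I_Q | x < p.+1%:R]|%:R <= Q%:R - x + 1.
Proof.
move=> /andP[x0 xQ]; have tx : (Num.truncn x)%:R <= x by rewrite truncn_le.
have mQ : (Num.truncn x <= Q)%N.
  by rewrite -(ler_nat R) (le_trans tx).
apply: (@le_trans _ _ (Q - Num.truncn x)%N%:R).
  rewrite ler_nat; apply: card_ord_interval => p /= px; rewrite ltn_ord andbT.
  by rewrite -ltnS -(ltr_nat R) (le_lt_trans tx).
by rewrite natrB //; have := truncnS_gt x; rewrite -natr1; lra.
Qed.

Lemma card_pairs (Q L : nat) (P : 'I_Q -> 'I_L -> bool) :
  #|[pred u : 'I_Q * 'I_L | P u.1 u.2]| = (\sum_i #|[pred p | P p i]|)%N.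
Proof.
rewrite -sum1_card; under [RHS]eq_bigr => i _ do rewrite -sum1_card.
rewrite [RHS](exchange_big_dep xpredT) //= pair_big_dep /=.
by apply: eq_bigl => -[p i]; rewrite !inE.
Qed.

Variable gamma : R.
Hypothesis gamma_gt0 : 0 < gamma.

Lemma ltr_powR_inv (x y : R) : 0 <= y -> x `^ gamma < y `^ gamma -> 0 <= x -> x < y.
Proof.
move=> y0 h x0; rewrite ltNge; apply/negP => yx; move: h; rewrite ltNge.
by rewrite ge0_ler_powR ?nnegrE // ltW.
Qed.

Lemma powRVK (x : R) : 0 <= x -> (x `^ gamma^-1) `^ gamma = x.
Proof. by move=> x0; rewrite -powRrM mulVf ?gt_eqF // powRr1. Qed.

Lemma powR_inv_eq (x : R) : 0 <= x -> x^-1 `^ gamma = x `^ (- gamma).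
Proof. by move=> x0; rewrite -powR_inv1 // -powRrM mulN1r. Qed.

Lemma weight_mulE (L p : nat) (beta : R) : 0 <= beta ->
  weight gamma L p * beta = (beta `^ gamma^-1 / (p.+1 * L)%N%:R) `^ gamma.
Proof.
move=> b0; rewrite powRM ?powR_ge0 ?invr_ge0 ?ler0n // powRVK //.
by rewrite powR_inv_eq ?ler0n // mulrC.
Qed.

(** Whether the singular value of the model attached to the block [p] and to the
   modulus [beta] of the symbol exceeds the threshold [T `^ (- gamma)] is decided
   by comparing [p.+1] with a number proportional to [T]. *)
Lemma weight_gt (L p : nat) (T beta : R) : (0 < L)%N -> 0 < T -> 0 <= beta ->
  T `^ (- gamma) < weight gamma L p * beta ->
  p.+1%:R < T * beta `^ gamma^-1 / L%:R.
Proof.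
move=> L0 T0 b0; have LR : 0 < L%:R :> R by rewrite ltr0n.
have pL : 0 < (p.+1 * L)%N%:R :> R by rewrite ltr0n muln_gt0 L0.
rewrite weight_mulE // -powR_inv_eq ?ltW // => /ltr_powR_inv.
rewrite divr_ge0 ?powR_ge0 ?invr_ge0 ?ltW // => /(_ isT isT).
rewrite ltr_pdivlMr // mulrC ltr_pdivrMr // [_ * T]mulrC => h.
by rewrite ltr_pdivlMr // -natrM.
Qed.

Lemma weight_lt (L p : nat) (T beta : R) : (0 < L)%N -> 0 < T -> 0 <= beta ->
  weight gamma L p * beta < T `^ (- gamma) ->
  T * beta `^ gamma^-1 / L%:R < p.+1%:R.
Proof.
move=> L0 T0 b0; have LR : 0 < L%:R :> R by rewrite ltr0n.
have pL : 0 < (p.+1 * L)%N%:R :> R by rewrite ltr0n muln_gt0 L0.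
rewrite weight_mulE // -powR_inv_eq ?ltW // => /ltr_powR_inv.
rewrite divr_ge0 ?powR_ge0 ?invr_ge0 ?ltW // => /(_ isT isT).
rewrite ltr_pdivrMr // mulrC ltr_pdivlMr // [_ * T]mulrC => h.
by rewrite ltr_pdivrMr // -natrM.
Qed.

Lemma count_above (L Q : nat) (T : R) (beta : nat -> R) :
  (0 < L)%N -> 0 < T -> (forall i, 0 <= beta i) ->
  #|[pred u : 'I_Q * 'I_L | T `^ (- gamma) < weight gamma L u.1 * beta u.2]|%:R
    <= T * ((\sum_(i < L) beta i `^ gamma^-1) / L%:R).
Proof.
move=> L0 T0 b0; have LR : 0 < L%:R :> R by rewrite ltr0n.
rewrite (card_pairs (fun (p : 'I_Q) (i : 'I_L) => T `^ (- gamma) < weight gamma L p * beta i)).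
rewrite natr_sum mulrA mulr_sumr mulr_suml; apply: ler_sum => i _.
have x0 : 0 <= T * beta i `^ gamma^-1 / L%:R by rewrite divr_ge0 ?mulr_ge0 ?powR_ge0 // ltW.
apply: le_trans (card_succ_lt Q x0); rewrite ler_nat; apply: subset_leq_card.
by apply/fintype.subsetP => p; rewrite !inE => /weight_gt; apply.
Qed.

Lemma count_below (L Q : nat) (T : R) (beta : nat -> R) :
  (0 < L)%N -> 0 < T -> (forall i, 0 <= beta i) ->
  (forall i, (i < L)%N -> T * beta i `^ gamma^-1 <= (Q * L)%N%:R) ->
  #|[pred u : 'I_Q * 'I_L | weight gamma L u.1 * beta u.2 < T `^ (- gamma)]|%:R
    <= (Q * L)%N%:R + L%:R - T * ((\sum_(i < L) beta i `^ gamma^-1) / L%:R).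
Proof.
move=> L0 T0 b0 hQ; have LR : 0 < L%:R :> R by rewrite ltr0n.
rewrite (card_pairs (fun (p : 'I_Q) (i : 'I_L) => weight gamma L p * beta i < T `^ (- gamma))).
have -> : (Q * L)%N%:R + L%:R - T * ((\sum_(i < L) beta i `^ gamma^-1) / L%:R) =
    \sum_(i < L) (Q%:R - T * beta i `^ gamma^-1 / L%:R + 1).
  rewrite big_split /= sumrB !sumr_const card_ord mulrA mulr_sumr mulr_suml.
  by rewrite natrM -[Q%:R *+ L]mulr_natr addrAC.
rewrite natr_sum; apply: ler_sum => i _.
have x0 : 0 <= T * beta i `^ gamma^-1 / L%:R <= Q%:R.
  rewrite divr_ge0 ?mulr_ge0 ?powR_ge0 ?(ltW T0) //=.
  by rewrite ler_pdivrMr // -natrM hQ.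
apply: le_trans (card_succ_gt x0); rewrite ler_nat; apply: subset_leq_card.
by apply/fintype.subsetP => p; rewrite !inE => /weight_lt; apply.
Qed.

End Counting.

(** * Asymptotics of the singular values *)

Section Asymptotics.
Variables (R : realType) (gamma : R) (M : nat) (b : int -> R[i]).
Variable a : nat -> nat -> R[i].
Hypothesis gamma_gt0 : 0 < gamma.
Hypothesis a_band : banded M a.
Hypothesis a_diag : forall m : int, (absz m <= M)%N -> forall eps : R, 0 < eps ->
  exists N : nat, forall j, (N <= j)%N ->
    normc (a j (absz (j%:Z + m)) - b m * (j%:R `^ (- gamma))%:C)
      <= eps * j%:R `^ (- gamma).

Let mean (L : nat) : R :=
  (\sum_(i < L) normc (symbol M b (angle R L i)) `^ gamma^-1) / L%:R.

Let Delta : R := \int[lebesgue_measure]_(t in `[- pi, pi])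
  (normc (symbol M b t) `^ (gamma^-1) / (2 * pi)).

Lemma entries_small (eta : R) : 0 < eta ->
  exists K : nat, forall j k, (K <= k)%N -> normc (a j k) <= eta.
Proof.
move=> eta0; have [P0 hP0] := block_close gamma_gt0 a_band a_diag (ltn0Sn 0) ltr01.
have C0 : 0 < 1 + coeff_norm M b by rewrite ltr_pwDl ?coeff_norm_ge0.
pose X := (1 + coeff_norm M b) / eta.
have X0 : 0 < X by rewrite divr_gt0.
exists (P0 + Num.truncn (X `^ gamma^-1))%N => j k Kk.
have := hP0 k 0%N j (leq_trans (leq_addr _ _) Kk) (ltn0Sn 0).
rewrite muln1 addn0 mul1r => h; have w0 := weight_ge0 gamma 1 k.
rewrite -[a j k](subrK ((weight gamma 1 k)%:C * toeplitz M b j k)).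
apply: (le_trans (normcD _ _)).
apply: (@le_trans _ _ ((1 + coeff_norm M b) * weight gamma 1 k)).
  rewrite mulrDl mul1r lerD // normcM normc_real ger0_norm //.
  by rewrite mulrC ler_wpM2r // normc_toeplitz_le.
have Xk : X `^ gamma^-1 <= (k.+1 * 1)%N%:R.
  rewrite muln1; apply: (le_trans (ltW (truncnS_gt _))).
  by rewrite ler_nat ltnS (leq_trans _ Kk) // leq_addl.
have Xp : 0 < X `^ gamma^-1 by rewrite powR_gt0.
apply: (@le_trans _ _ ((1 + coeff_norm M b) * X^-1)).
  rewrite ler_pM2l //; apply: (le_trans (powRN_anti gamma_gt0 Xp Xk)).
  by rewrite powRN (powRVK gamma_gt0 (ltW X0)).
by rewrite /X invf_div mulrC divfK ?gt_eqF.
Qed.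

Lemma matrix_op_tail (eps : R) : 0 < eps -> exists K : nat, forall x : l2 R,
  (forall k, (k < K)%N -> x k = 0) -> l2norm (matrix_op a x) <= eps * l2norm x.
Proof.
move=> eps0; have [c hc] := entries_bounded gamma_gt0 a_band a_diag.
have M0 : 0 < (2 * M).+1%:R :> R by rewrite ltr0n.
have eta0 : 0 < eps / (2 * M).+1%:R by rewrite divr_gt0.
have [K hK] := entries_small eta0; exists K => x hx.
have -> : eps = (2 * M).+1%:R * (eps / (2 * M).+1%:R) by rewrite mulrC divfK ?gt_eqF.
apply: (matrix_op_bound a_band hc) => [|j k]; first exact: ltW.
have [kK|Kk] := ltnP k K; first by rewrite hx // mulr0 normc0E mulr0.
by rewrite normcM ler_wpM2r ?normc_ge0 ?hK.
Qed.

Lemma mean_cvg (eps : R) : 0 < eps ->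
  exists n0 : nat, forall L, (n0 <= L)%N -> (0 < L)%N -> `|mean L - Delta| <= eps.
Proof.
move=> eps0; have pi0 := pi_gt0 R.
pose f (t : R) := normc (symbol M b t) `^ (gamma^-1) / (2 * pi).
have fc : continuous f.
  move=> t; apply: cvgM; last exact: cvg_cst.
  apply: cvg_powR; rewrite ?invr_gt0 ?normc_ge0 //; first by move=> ?; exact: normc_ge0.
  exact: continuous_symbol.
have [|n0 hn0] := @Riemann_sum_cvg R f (- pi) pi eps fc _ eps0; first by lra.
exists n0 => L Ln L0; have := hn0 L Ln L0; rewrite -/Delta.
suff -> : \sum_(k < L) f (- pi + (pi - - pi) * k%:R / L%:R) * ((pi - - pi) / L%:R) = mean L.
  by [].
rewrite /mean mulr_suml; apply: eq_bigr => k _; rewrite /f -/(angle R L k).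
have Lne : L%:R != 0 :> R by rewrite pnatr_eq0 -lt0n.
have pine : pi != 0 :> R by rewrite gt_eqF.
have key (x y p : R) : y != 0 -> p != 0 -> x / (2 * p) * ((p - - p) / y) = x / y.
  by move=> y0 p0; field; rewrite y0 p0.
exact: key.
Qed.

Local Notation bmax := (coeff_norm M b).

(** The parameters of the model for the threshold [T `^ (- gamma)]. [L] is fixed
   first, large enough for [mean L] to be close to the integral and for the
   block boundaries (about [2 M / L] of the indices) to be negligible. The
   [P1 * L] first indices, which are discarded, are a small proportion of [T].
   The model stops at an index [Q * L] of the order of [H * T], beyond which the
   entries are small compared with the threshold. *)
Lemma block_parameters (kappa r : R) : 0 < kappa -> 0 < r ->
  exists L : nat, [/\ (0 < L)%N, `|mean L - Delta| <= kappa / 4 &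
    exists T0 : R, forall T, 0 < T -> T0 <= T -> exists P1 Q : nat, exists d : R,
     [/\ [/\ 0 <= d, (2 * M).+1%:R * d <= r * T `^ (- gamma) &
       (P1 * L + Q * (2 * M) + L)%N%:R <= kappa * T / 2],
       forall i, T * normc (symbol M b (angle R L i)) `^ gamma^-1 <= (Q * L)%N%:R,
       forall p r' j, (P1 <= p < Q)%N -> (r' < L)%N ->
         normc (a j (p * L + r') - (weight gamma L p)%:C * toeplitz M b j (p * L + r')) <= d &
       forall j k, (Q * L <= k)%N -> normc (a j k) <= d]].
Proof.
move=> kappa0 r0.
have B0 : 0 <= bmax by exact: coeff_norm_ge0.
have M0 : 0 < (2 * M).+1%:R :> R by rewrite ltr0n.
(* The first term of [H] makes the entries beyond [Q * L] small, the second one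
   ensures that all the singular values of the model above the threshold come
   from the first [Q] blocks. *)
pose X := (1 + bmax) * (2 * M).+1%:R / r.
have X0 : 0 < X by rewrite divr_gt0 ?mulr_gt0 // ltr_pwDl.
pose H := X `^ gamma^-1 + bmax `^ gamma^-1.
have H0 : 0 < H by rewrite ltr_pwDl ?powR_gt0 ?powR_ge0.
have kap4 : 0 < kappa / 4 by rewrite divr_gt0.
have kap8 : 0 < kappa / 8 by rewrite divr_gt0.
have [n0 hn0] := mean_cvg kap4.
have [L [L0 hmean hL]] : exists L : nat, [/\ (0 < L)%N,
    `|mean L - Delta| <= kappa / 4 & 2 * M%:R * H / L%:R <= kappa / 8].
  pose L := (n0 + (Num.truncn (2 * M%:R * H / (kappa / 8))).+1)%N.
  have L0 : (0 < L)%N by rewrite /L addnS.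
  exists L; split=> //; first by apply: hn0; rewrite // /L leq_addr.
  rewrite ler_pdivrMr ?ltr0n // -ler_pdivrMl // mulrC.
  apply: (le_trans (ltW (truncnS_gt _))); rewrite ler_nat /L; exact: leq_addl.
have LR : 0 < L%:R :> R by rewrite ltr0n.
exists L; split=> //.
pose eps' := r / (2 * M).+1%:R * (kappa / 8) `^ gamma.
have eps'0 : 0 < eps' by rewrite mulr_gt0 ?divr_gt0 ?powR_gt0.
have [P0 hP0] := block_close gamma_gt0 a_band a_diag L0 eps'0.
have [P0' hP0'] := block_close gamma_gt0 a_band a_diag L0 ltr01.
(* The three terms give [P0 <= P1], [P0' <= Q] and [2 * M + L <= kappa / 8 * T]. *)
pose T0 := L%:R * P0%:R / (kappa / 8) + L%:R * P0'%:R / H +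
  (2 * M + L)%N%:R / (kappa / 8).
have t1 : 0 <= L%:R * P0%:R / (kappa / 8) by rewrite divr_ge0 ?mulr_ge0 // ltW.
have t2 : 0 <= L%:R * P0'%:R / H by rewrite divr_ge0 ?mulr_ge0 // ltW.
have t3 : 0 <= (2 * M + L)%N%:R / (kappa / 8) by rewrite divr_ge0 // ltW.
exists T0 => T Tp TT0.
have T1 : L%:R * P0%:R / (kappa / 8) <= T by rewrite /T0 in TT0; lra.
have T2 : L%:R * P0'%:R / H <= T by rewrite /T0 in TT0; lra.
have T3 : (2 * M + L)%N%:R / (kappa / 8) <= T by rewrite /T0 in TT0; lra.
have x1 : 0 <= kappa / 8 * T / L%:R by rewrite divr_ge0 ?mulr_ge0 // ltW.
have x2 : 0 <= H * T / L%:R by rewrite divr_ge0 ?mulr_ge0 // ltW.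
pose P1 := Num.truncn (kappa / 8 * T / L%:R).
pose Q := (Num.truncn (H * T / L%:R)).+1.
pose d := r * T `^ (- gamma) / (2 * M).+1%:R.
have P1le : P1%:R * L%:R <= kappa / 8 * T.
  by rewrite -ler_pdivlMr // truncn_le.
have P1gt : kappa / 8 * T <= P1.+1%:R * L%:R.
  by rewrite -ler_pdivrMr // ltW // truncnS_gt.
have Qgt : H * T <= Q%:R * L%:R.
  by rewrite -ler_pdivrMr // ltW // truncnS_gt.
have Qle : Q%:R <= H * T / L%:R + 1.
  by rewrite -natr1 lerD2r truncn_le.
have P0P1 : (P0 <= P1)%N.
  rewrite /P1 truncn_ge_nat // ler_pdivlMr // mulrC [_ * T]mulrC.
  by rewrite -ler_pdivrMr.
have P0'Q : (P0' <= Q)%N.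
  apply: leqW; rewrite truncn_ge_nat // ler_pdivlMr // mulrC [_ * T]mulrC.
  by rewrite -ler_pdivrMr.
clearbody P1 Q; have Tg0 : 0 <= T `^ (- gamma) by exact: powR_ge0.
have anti := powRN_anti gamma_gt0.
exists P1, Q, d; split.
- split.
  + by rewrite divr_ge0 ?mulr_ge0 // ltW.
  + by rewrite /d mulrC divfK ?gt_eqF.
  have h3 : (2 * M + L)%N%:R <= kappa / 8 * T by rewrite mulrC -ler_pdivrMr.
  have h4 : Q%:R * (2 * M%:R) <= kappa / 8 * T + 2 * M%:R.
    apply: (@le_trans _ _ ((H * T / L%:R + 1) * (2 * M%:R))).
      by rewrite ler_wpM2r ?mulr_ge0.
    have -> : (H * T / L%:R + 1) * (2 * M%:R) = 2 * M%:R * H / L%:R * T + 2 * M%:R.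
      by ring.
    by rewrite lerD2r ler_pM2r.
  have kT : 0 < kappa * T by rewrite mulr_gt0.
  have kE : kappa / 8 * T = (kappa * T) / 8 by ring.
  rewrite kE in P1le h3 h4; rewrite natrD natrM in h3.
  rewrite !natrD !natrM; lra.
- move=> i; rewrite natrM; apply: le_trans Qgt; rewrite mulrC ler_pM2r //.
  apply: (@le_trans _ _ (bmax `^ gamma^-1)); last by rewrite lerDr powR_ge0.
  apply: ge0_ler_powR; rewrite ?nnegrE ?normc_ge0 ?invr_ge0 ?(ltW gamma_gt0) //.
  exact: normc_symbol_le.
- move=> p r' j /andP[P1p _] jL; apply: (le_trans (hP0 _ _ _ (leq_trans P0P1 P1p) jL)).
  apply: (@le_trans _ _ (eps' * (kappa / 8 * T) `^ (- gamma))).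
    rewrite ler_pM2l //; apply: (le_trans (weight_nonincreasing _ L0 P1p)) => //.
    by rewrite /weight; apply: anti; rewrite ?mulr_gt0 // natrM.
  have -> : (kappa / 8 * T) `^ (- gamma) = ((kappa / 8) `^ gamma)^-1 * T `^ (- gamma).
    by rewrite -powRN; exact: powRM (ltW kap8) (ltW Tp).
  rewrite /eps' /d; have key (u v x y : R) : v != 0 -> u / y * v * (v^-1 * x) = u * x / y.
    by move=> v0; rewrite mulrA mulfK // mulrAC.
  by rewrite key // gt_eqF // powR_gt0.
move=> j k Qk.
have Qkp : (Q <= k %/ L)%N by rewrite leq_divRL.
have kL : (k %% L < L)%N by rewrite ltn_mod.
have := hP0' (k %/ L)%N (k %% L)%N j (leq_trans P0'Q Qkp) kL.
rewrite -divn_eq mul1r => h.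
have w0 : 0 <= weight gamma L (k %/ L)%N by exact: weight_ge0.
apply: (@le_trans _ _ ((1 + bmax) * weight gamma L (k %/ L)%N)).
  rewrite -[a j k](subrK ((weight gamma L (k %/ L)%N)%:C * toeplitz M b j k)).
  rewrite (le_trans (normcD _ _)) // mulrDl mul1r lerD // normcM normc_real ger0_norm //.
  by rewrite mulrC ler_wpM2r // normc_toeplitz_le.
apply: (@le_trans _ _ ((1 + bmax) * (H * T) `^ (- gamma))).
  rewrite ler_wpM2l ?addr_ge0 // /weight; apply: anti; rewrite ?mulr_gt0 //.
  apply: (le_trans Qgt); rewrite -natrM ler_nat leq_mul2r.
  by rewrite (leq_trans Qkp) ?orbT // leqW.
have -> : (H * T) `^ (- gamma) = (H `^ gamma)^-1 * T `^ (- gamma).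
  by rewrite -powRN; exact: powRM (ltW H0) (ltW Tp).
rewrite mulrA /d [leRHS]mulrAC ler_wpM2r //.
rewrite ler_pdivrMr ?powR_gt0 // mulrC -ler_pdivrMr ?divr_gt0 //.
have -> : (1 + bmax) / (r / (2 * M).+1%:R) = X.
  by rewrite /X invf_div mulrA.
rewrite -[leLHS](powRVK gamma_gt0 (ltW X0)).
by apply: ge0_ler_powR; rewrite ?nnegrE ?powR_ge0 ?(ltW gamma_gt0) ?(ltW H0) // lerDl powR_ge0.
Qed.

Variable e : nat -> l2 R.
Hypothesis he : forall n,
  [/\ l2norm (e n) = 1, forall i, (i < n)%N -> dot (e n) (e i) = 0 &
    forall x, (forall i, (i < n)%N -> dot x (e i) = 0) ->
      l2norm (matrix_op a x) <= l2norm (matrix_op a (e n)) * l2norm x].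

Let s n := l2norm (matrix_op a (e n)).

Lemma powR_scale (D : R) (n : nat) : 0 < D ->
  (n%:R / D) `^ (- gamma) = D `^ gamma * n%:R `^ (- gamma).
Proof.
move=> D0; rewrite powRM ?invr_ge0 ?ler0n ?(ltW D0) // mulrC; congr (_ * _).
by rewrite -powR_inv1 ?(ltW D0) // -powRrM mulN1r opprK.
Qed.

(** The threshold is chosen such that [n = T * D]: at most about [T * Delta]
   singular values of the model lie above it, so fewer than [n]. *)
Lemma singular_eventually_le (D r : R) : 0 < D -> Delta < D -> 0 < r ->
  exists n0 : nat, forall n, (n0 <= n)%N ->
    s n <= (1 + r) * D `^ gamma * n%:R `^ (- gamma).
Proof.
move=> D0 DD r0; have [c hc] := entries_bounded gamma_gt0 a_band a_diag.
have kappa0 : 0 < D - Delta by rewrite subr_gt0.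
have [L [L0 hL [T0 hT0]]] := block_parameters kappa0 r0.
exists (Num.truncn (T0 * D)).+1 => n n0.
have n_gt0 : 0 < n%:R :> R by rewrite ltr0n (leq_ltn_trans _ n0).
have T_gt0 : 0 < n%:R / D by rewrite divr_gt0.
have TT0 : T0 <= n%:R / D.
  by rewrite ler_pdivlMr // (le_trans (ltW (truncnS_gt _))) // ler_nat.
have [P1 [Q [d [[d0 hd hP] _ hclose hsmall]]]] := hT0 _ T_gt0 TT0.
rewrite -mulrA -powR_scale // mulrDl mul1r.
have b0 i : 0 <= normc (symbol M b (angle R L i)) by exact: normc_ge0.
have hcnt := count_above gamma_gt0 Q L0 T_gt0 b0.
apply: le_trans (_ : (n%:R / D) `^ (- gamma) + (2 * M).+1%:R * d <= _); last first.
  by rewrite lerD2l.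
apply: (singular_le_count a_band hc L0 (weight_ge0 gamma L) d0 hclose hsmall he).
  exact: powR_ge0.
rewrite -(ler_nat R) natrD.
have hm : mean L <= Delta + (D - Delta) / 4.
  by have := le_trans (ler_norm _) hL; lra.
have hTm : n%:R / D * mean L <= n%:R / D * (Delta + (D - Delta) / 4).
  by rewrite ler_pM2l.
have nE : n%:R = n%:R / D * D by rewrite divfK ?gt_eqF.
have hP' : (P1 * L + Q * (2 * M))%N%:R <= (D - Delta) * (n%:R / D) / 2.
  by apply: le_trans hP; rewrite ler_nat leq_addr.
apply: (le_trans (lerD hP' hcnt)); rewrite -/(mean L).
apply: (le_trans (lerD (lexx _) hTm)); rewrite [leRHS]nE -subr_ge0.
have -> : n%:R / D * D - ((D - Delta) * (n%:R / D) / 2 + n%:R / D * (Delta + (D - Delta) / 4))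
    = (n%:R / D) * (D - Delta) / 4 by move: (n%:R / D) => u; field.
by rewrite divr_ge0 // mulr_ge0 ?(ltW T_gt0) ?(ltW kappa0).
Qed.

Lemma singular_eventually_ge (D r : R) : 0 < D -> D < Delta -> 0 < r ->
  exists n0 : nat, forall n, (n0 <= n)%N ->
    (1 - r) * D `^ gamma * n%:R `^ (- gamma) <= s n.
Proof.
move=> D0 DD r0; have [c hc] := entries_bounded gamma_gt0 a_band a_diag.
have kappa0 : 0 < Delta - D by rewrite subr_gt0.
have [L [L0 hL [T0 hT0]]] := block_parameters kappa0 r0.
exists (Num.truncn (T0 * D)).+1 => n n0.
have n_gt0 : 0 < n%:R :> R by rewrite ltr0n (leq_ltn_trans _ n0).
have T_gt0 : 0 < n%:R / D by rewrite divr_gt0.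
have TT0 : T0 <= n%:R / D.
  by rewrite ler_pdivlMr // (le_trans (ltW (truncnS_gt _))) // ler_nat.
have [P1 [Q [d [[d0 hd hP] hQ hclose hsmall]]]] := hT0 _ T_gt0 TT0.
rewrite -mulrA -powR_scale // mulrBl mul1r.
have b0 i : 0 <= normc (symbol M b (angle R L i)) by exact: normc_ge0.
have hcnt := count_below gamma_gt0 L0 T_gt0 b0 (fun i _ => hQ i).
apply: (@le_trans _ _ ((n%:R / D) `^ (- gamma) - (2 * M).+1%:R * d)).
  by rewrite lerD2l lerN2.
apply: (singular_ge_count a_band hc L0 (weight_ge0 gamma L) d0 hclose hsmall he).
  exact: powR_ge0.
have hm : Delta - (Delta - D) / 4 <= mean L.
  by move: hL; rewrite ler_norml => /andP[h _]; lra.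
have hTm : n%:R / D * (Delta - (Delta - D) / 4) <= n%:R / D * mean L.
  by rewrite ler_pM2l.
have nE : n%:R = n%:R / D * D by rewrite divfK ?gt_eqF.
rewrite -/(mean L) in hcnt.
rewrite -(ltr_nat R) !natrD; rewrite !natrD in hP.
set N := #|_| in hcnt *.
have gap : 0 < n%:R / D * (Delta - D) / 4 by rewrite divr_gt0 // mulr_gt0.
have idE : n%:R / D * (Delta - (Delta - D) / 4) =
    n%:R / D * D + (Delta - D) * (n%:R / D) / 2 + n%:R / D * (Delta - D) / 4.
  by move: (n%:R / D) => u; field.
rewrite idE -nE in hTm.
move: hP hcnt hTm gap.
move: (n%:R / D * mean L) (n%:R / D * (Delta - D) / 4) ((Delta - D) * (n%:R / D) / 2).
move=> u1 u2 u3; lra.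
Qed.

Lemma Delta_ge0 : 0 <= Delta.
Proof.
apply: Rintegral_ge0 => t _; rewrite divr_ge0 ?powR_ge0 // mulr_ge0 //.
exact: pi_ge0.
Qed.

Lemma singular_asymptotics (eps : R) : 0 < eps ->
  exists n0 : nat, forall n, (n0 <= n)%N ->
    `|s n - Delta `^ gamma * n%:R `^ (- gamma)| <= eps * n%:R `^ (- gamma).
Proof.
move=> eps0; have D0 := Delta_ge0; set G := Delta `^ gamma.
have G0 : 0 <= G by exact: powR_ge0.
have root (x : R) : 0 <= x -> x `^ gamma^-1 `^ gamma = x := @powRVK R gamma gamma_gt0 x.
have DE : Delta = G `^ gamma^-1.
  by rewrite /G -powRrM mulfV ?gt_eqF // powRr1.
have igamma : 0 < gamma^-1 by rewrite invr_gt0.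
have [n1 hn1] : exists n0 : nat, forall n, (n0 <= n)%N ->
    s n <= (G + eps) * n%:R `^ (- gamma).
  (* Half of [eps] is spent on [D], chosen with [D `^ gamma = G + eps / 2], and
     the other half on the factor [1 + r]. *)
  have E0 : 0 < G + eps / 2 by lra.
  have h1 : Delta < (G + eps / 2) `^ gamma^-1.
    by rewrite DE; apply: gt0_ltr_powR; rewrite ?nnegrE ?(ltW E0) //; lra.
  have h2 : 0 < eps / 2 / (G + eps / 2) by rewrite !divr_gt0.
  have [n0 hn0] := singular_eventually_le (powR_gt0 _ E0) h1 h2.
  exists n0 => n /hn0; rewrite root ?(ltW E0) //.
  have -> : (1 + eps / 2 / (G + eps / 2)) * (G + eps / 2) = G + eps.
    by rewrite mulrDl mul1r divfK ?gt_eqF //; field.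
  by [].
have [n2 hn2] : exists n0 : nat, forall n, (n0 <= n)%N ->
    (G - eps) * n%:R `^ (- gamma) <= s n.
  have [Ge|eG] := leP G eps.
    exists 0%N => n _; apply: (@le_trans _ _ 0); last exact: l2norm_ge0.
    by rewrite mulr_le0_ge0 ?powR_ge0 // subr_le0.
  have E0 : 0 < G - eps / 2 by lra.
  have h1 : (G - eps / 2) `^ gamma^-1 < Delta.
    by rewrite DE; apply: gt0_ltr_powR; rewrite ?nnegrE ?(ltW E0) //; lra.
  have h2 : 0 < eps / 2 / (G - eps / 2) by rewrite !divr_gt0.
  have [n0 hn0] := singular_eventually_ge (powR_gt0 _ E0) h1 h2.
  exists n0 => n /hn0; rewrite root ?(ltW E0) //.
  have -> : (1 - eps / 2 / (G - eps / 2)) * (G - eps / 2) = G - eps.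
    by rewrite mulrBl mul1r divfK ?gt_eqF //; field.
  by [].
exists (n1 + n2)%N => n hn.
have := hn1 n (leq_trans (leq_addr _ _) hn); rewrite mulrDl.
have := hn2 n (leq_trans (leq_addl _ _) hn); rewrite mulrBl.
by move=> h1 h2; rewrite ler_norml; apply/andP; split; lra.
Qed.

End Asymptotics.

Theorem theorem1p2 (R : realType) (gamma : R) (M : nat) (b : int -> R[i])
    (a : nat -> nat -> R[i])
    (gamma_gt0 : 0 < gamma)
    (a_band : forall j k : nat, (M < `|k%:Z - j%:Z|)%N -> a j k = 0)
    (a_diag : forall m : int, (absz m <= M)%N ->
       (fun j : nat => a j (absz (j%:Z + m)) - b m * (j%:R `^ (- gamma))%:C : R[i]^o)
         =o_\oo (fun j : nat => (j%:R `^ (- gamma))%:C : R[i]^o)) :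
  (fun n : nat => singular_value (matrix_op a) n -
     (\int[lebesgue_measure]_(t in `[- pi, pi])
        (normc (symbol M b t) `^ (gamma^-1) / (2 * pi))) `^ gamma
     * n%:R `^ (- gamma))
    =o_\oo (fun n : nat => n%:R `^ (- gamma)).
Proof.
have ha : banded M a.
  move=> j k far; apply: a_band; move: far; rewrite /near_diag; lia.
have hd (m : int) : (absz m <= M)%N -> forall eps : R, 0 < eps ->
    exists N : nat, forall j, (N <= j)%N ->
      normc (a j (absz (j%:Z + m)) - b m * (j%:R `^ (- gamma))%:C)
        <= eps * j%:R `^ (- gamma).
  move=> mM eps eps0; have /eqoP h := a_diag m mM.
  have eC : 0 < eps%:C :> R[i] by rewrite ltcR.
  have [N _ hN] := h _ eC; exists N => j Nj; have := hN j Nj => /= hj.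
  have hj' : (normc (a j (absz (j%:Z + m)) - b m * (j%:R `^ (- gamma))%:C))%:C <=
      eps%:C * (normc (j%:R `^ (- gamma))%:C)%:C := hj.
  by move: hj'; rewrite normc_real ger0_norm ?powR_ge0 // -rmorphM lecR.
have [c hc] := entries_bounded gamma_gt0 ha hd.
have c0 : 0 <= c := le_trans (normc_ge0 _) (hc 0%N 0%N).
have tail := matrix_op_tail gamma_gt0 ha hd.
have [e [he hs]] := exists_singular_system (matrix_opD ha hc) (matrix_opZ ha hc)
  (matrix_op_bounded ha hc) (mulr_ge0 (ler0n _ _) c0) tail
  (fun x y => dot_matrix_op x y ha hc).
apply/eqoP => eps eps0.
have [n0 hn0] := singular_asymptotics gamma_gt0 ha hd he eps0.
exists n0 => // n /= n0n; rewrite hs [X in _ <= _ * X]ger0_norm ?powR_ge0 //.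
exact: hn0.
Qed.
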